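(* Let $K\ge 1$, $\lambda>0$ and $m\in\mathbb{N}$. Let $R^{**}_{K,m,\lambda}$ be the unique root in $(0,1)$ of the equation $$F^{\lambda}_{K,m}(r):=\frac{r^m}{1-r^m}+\frac{r}{(1-r^m)^2}+\frac{\lambda\,(K-1+r(K+1))\,r}{(K+1)(1-r)}-\frac12=0 .$$ Suppose that $f(z)=h(z)+\overline{g(z)}=\sum_{n=0}^{\infty}a_nz^n+\overline{\sum_{n=1}^{\infty}b_nz^n}$ is a sense-preserving $K$-quasiconformal harmonic mapping in $\mathbb{D}$ and $h\prec\phi$, where $\phi$ is an analytic convex univalent function in $\mathbb{D}$. Then $$|h(z^m)|+|h'(z^m)|\,r+\lambda\left(\sum_{n=2}^{\infty}|a_n|r^n+\sum_{n=1}^{\infty}|b_n|r^n\right)\le|\phi(0)|+d(\phi(0),\partial\phi(\mathbb{D}))$$ for $|z|=r\le\min\{1/3,R^{**}_{K,m,\lambda}\}$. Here $h'(z^m)$ is the value of $h'$ at the point $z^m$. Moreover, if $R^{**}_{K,m,\lambda}\le1/3$, the number $R^{**}_{K,m,\lambda}$ is sharp, i.e. it cannot be replaced by any larger number in this statement (over all admissible $f$ and $\phi$).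
   Context: $\mathbb{D}=\{z\in\mathbb{C}:|z|<1\}$. A convex univalent function in $\mathbb{D}$ is an analytic univalent function $\phi$ on $\mathbb{D}$ whose image $\phi(\mathbb{D})$ is a convex set. $d(\phi(0),\partial\phi(\mathbb{D}))$ is the Euclidean distance from $\phi(0)$ to the boundary of $\phi(\mathbb{D})$. For analytic $h,\phi$ in $\mathbb{D}$, $h\prec\phi$ ($h$ is subordinate to $\phi$) means $h=\phi\circ w$ for some analytic $w:\mathbb{D}\to\mathbb{D}$ with $w(0)=0$. A harmonic mapping $f=h+\overline g$ in $\mathbb{D}$ ($h,g$ analytic) is sense-preserving $K$-quasiconformal if it is locally univalent and sense-preserving (i.e. $h'\ne0$ and $|\omega|<1$ in $\mathbb{D}$, where $\omega=g'/h'$) and $|\omega(z)|\le k<1$ in $\mathbb{D}$, where $K=(1+k)/(1-k)\ge1$, i.e. $k=(K-1)/(K+1)$. *)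

(* Defs.v *)
From Stdlib Require Export Reals.
From Coquelicot Require Export Coquelicot.
Open Scope R_scope.

Definition unit_disc (z : C) : Prop := Cmod z < 1.

Definition analytic_on (U : C -> Prop) (f : C -> C) : Prop :=
  forall z0 : C, U z0 ->
    exists c : nat -> C,
      locally z0 (fun z : C => is_pseries c (z - z0)%C (f z)).

Definition univalent_on (U : C -> Prop) (f : C -> C) : Prop :=
  forall z w : C, U z -> U w -> f z = f w -> z = w.

Definition image (f : C -> C) (U : C -> Prop) : C -> Prop :=
  fun p => exists z : C, U z /\ f z = p.

Definition convex_set (S : C -> Prop) : Prop :=
  forall (p q : C) (t : R), S p -> S q -> 0 <= t <= 1 ->
    S (RtoC (1 - t) * p + RtoC t * q)%C.

Definition boundary (S : C -> Prop) : C -> Prop :=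
  fun p => forall eps : posreal,
    (exists q : C, Cmod (q - p) < eps /\ S q) /\
    (exists q : C, Cmod (q - p) < eps /\ ~ S q).

(* The infimum of [|q - p|] over [q] in [S]; the value is meaningful only for
   nonempty [S] ([real p_infty] is [0]).  A univalent analytic image of the
   disc is never the whole plane, so its boundary is nonempty. *)
Definition dist_to_set (p : C) (S : C -> Prop) : R :=
  real (Glb_Rbar (fun x : R => exists q : C, S q /\ x = Cmod (q - p))).

Definition convex_univalent (phi : C -> C) : Prop :=
  analytic_on unit_disc phi /\
  univalent_on unit_disc phi /\
  convex_set (image phi unit_disc).

Definition subordinate (h phi : C -> C) : Prop :=
  exists w : C -> C,
    analytic_on unit_disc w /\
    (forall z : C, unit_disc z -> unit_disc (w z)) /\
    w (RtoC 0) = RtoC 0 /\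
    (forall z : C, unit_disc z -> h z = phi (w z)).

Definition dilatation (h g : C -> C) (z : C) : C :=
  (C_derive g z / C_derive h z)%C.

Definition sense_preserving_qc (K : R) (f h g : C -> C) : Prop :=
  analytic_on unit_disc h /\
  analytic_on unit_disc g /\
  (forall z : C, unit_disc z -> f z = (h z + Cconj (g z))%C) /\
  (forall z : C, unit_disc z ->
     C_derive h z <> RtoC 0 /\
     Cmod (dilatation h g z) < 1 /\
     Cmod (dilatation h g z) <= (K - 1) / (K + 1)).

(* The condition [b 0 = 0] encodes that the expansion of [g] starts at n = 1. *)
Definition power_expansions (h g : C -> C) (a b : nat -> C) : Prop :=
  b 0%nat = RtoC 0 /\
  forall z : C, unit_disc z -> is_pseries a z (h z) /\ is_pseries b z (g z).

Definition bohr_sum (m : nat) (lambda : R) (h : C -> C) (a b : nat -> C)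
    (z : C) : R :=
  let r := Cmod z in
  Cmod (h (Cpow z m)) + Cmod (C_derive h (Cpow z m)) * r
  + lambda * (Series (fun n => Cmod (a (n + 2)%nat) * r ^ (n + 2))
              + Series (fun n => Cmod (b (n + 1)%nat) * r ^ (n + 1))).

Definition bohr_inequality_up_to (K : R) (m : nat) (lambda rho : R) : Prop :=
  forall (f h g : C -> C) (a b : nat -> C) (phi : C -> C),
    sense_preserving_qc K f h g ->
    power_expansions h g a b ->
    convex_univalent phi ->
    subordinate h phi ->
    forall z : C, unit_disc z -> Cmod z <= rho ->
      bohr_sum m lambda h a b z
      <= Cmod (phi (RtoC 0))
         + dist_to_set (phi (RtoC 0)) (boundary (image phi unit_disc)).

Definition F (K : R) (m : nat) (lambda r : R) : R :=
  r ^ m / (1 - r ^ m) + r / (1 - r ^ m) ^ 2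
  + lambda * (K - 1 + r * (K + 1)) * r / ((K + 1) * (1 - r)) - 1 / 2.

Definition root_in_unit_interval (K : R) (m : nat) (lambda r : R) : Prop :=
  0 < r < 1 /\ F K m lambda r = 0.

(* Main.v *)
From Stdlib Require Import Lra Lia ClassicalEpsilon Classical Ranalysis5.
Require Import Defs.

(** Write d for the distance from phi(0) to the boundary of the convex image of phi.

    The upper bound rests on coefficient estimates. A point q outside the convex
    image is separated from it by a line, so h - a_0, suitably rotated, maps the
    disc into a half-plane whose edge is at distance at most |q - a_0| from 0;
    Caratheodory's inequality then gives |a_n| <= 2 |q - a_0|, and letting q
    approach the nearest boundary point gives |a_n| <= 2 d for n >= 1
    ([subordinate_coefficient_le]). Summing power series bounds |h(z^m)|, |h'(z^m)|
    and the tail of the a_n by multiples of 2 d. The quotient omega = g'/h' is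
    bounded by k = (K-1)/(K+1), and Bohr's theorem says that the moduli of its Taylor
    coefficients c_n satisfy sum |c_n| r^n <= k for r <= 1/3
    ([bounded_tower_bohr]). Comparing coefficients in g' = omega h' gives
    sum |b_n| r^n <= k (sum of 2 d r^n) ([dilatation_bound_coefficients]). Adding up,
    the left-hand side is at most |a_0| + 2 d (F(r) + 1/2), which is at most
    |a_0| + d as soon as F(r) <= 0, that is r <= R, as F is increasing.

    For sharpness take h = phi = z/(1-z), the map onto the half-plane Re w > -1/2, for
    which d = 1/2, and g = k h. Every estimate above is then an equality at a
    positive z = r, so the sum equals F(r) + 1/2, which exceeds 1/2 for r > R.

    The function theory is developed without integration. Its only analytic engine is
    the maximum modulus principle, which holds for every function having three
    successive difference quotients at each point ([reg], [maximum_modulus]); this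
    class is visibly closed under the field operations and contains power series.
    Coefficient bounds come from Wiener's trick: averaging f over the rotations by n-th
    roots of unity leaves c_0 + c_n z^n + ..., and a Moebius map followed by
    division by z^n turns the bound on the average into a bound on c_n.

    That phi omits some value, without which the boundary would be empty and d
    meaningless, is [univalent_not_onto]: if phi were a bijection of the disc onto
    the plane, its inverse would be continuous by the open mapping theorem, so |phi|
    would tend to infinity at the unit circle, and z^k/(phi(z) - phi(0)), with k the
    order of the zero at 0, would violate the maximum principle. *)

(** * Limits, sums and power series in the complex plane *)

Definition Clim (u : nat -> C) (l : C) : Prop :=
  is_lim_seq (fun n => Cmod (u n - l)) 0.

Fixpoint csum (u : nat -> C) (n : nat) : C :=
  match n with
  | O => RtoC 0
  | S p => (csum u p + u p)%C
  end.

Definition psum (c : nat -> C) (z : C) : nat -> C :=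
  csum (fun k => (c k * z ^ k)%C).

Definition series_at (c : nat -> C) (z l : C) : Prop := Clim (psum c z) l.

Lemma Clim_eps u l : Clim u l <->
  forall eps : R, 0 < eps -> exists N, forall n, (N <= n)%nat -> Cmod (u n - l) < eps.
Proof.
  unfold Clim; rewrite <- is_lim_seq_spec; simpl; split.
  - intros H eps He. destruct (H (mkposreal eps He)) as [N HN]. exists N. intros n Hn.
    specialize (HN n Hn). simpl in HN. rewrite Rminus_0_r, Rabs_pos_eq in HN; auto using Cmod_ge_0.
  - intros H eps. destruct (H eps (cond_pos eps)) as [N HN]. exists N. intros n Hn.
    rewrite Rminus_0_r, Rabs_pos_eq; auto using Cmod_ge_0.
Qed.

Lemma Clim_squeeze u l v :
  (forall n, Cmod (u n - l) <= v n) -> is_lim_seq v 0 -> Clim u l.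
Proof.
  intros H Hv. unfold Clim. apply is_lim_seq_le_le with (fun _ => 0) v; auto.
  - intros n; split; auto using Cmod_ge_0.
  - apply is_lim_seq_const.
Qed.

Lemma Clim_ext u v l : (forall n, u n = v n) -> Clim u l -> Clim v l.
Proof. intros H. apply is_lim_seq_ext. intros; now rewrite H. Qed.

Lemma Clim_unique u l1 l2 : Clim u l1 -> Clim u l2 -> l1 = l2.
Proof.
  intros H1 H2.
  assert (H : is_lim_seq (fun n => Cmod (u n - l1) + Cmod (u n - l2)) (0 + 0)).
  { now apply is_lim_seq_plus'. }
  assert (H0 : Rbar_le (Cmod (l2 - l1)) (0 + 0)).
  { apply (is_lim_seq_le (fun _ => Cmod (l2 - l1)) _ _ _) with (2 := is_lim_seq_const _) (3 := H).
    intros n. replace (l2 - l1)%C with ((u n - l1) + - (u n - l2))%C by ring.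
    rewrite <- (Cmod_opp (u n - l2)). apply Cmod_triangle. }
  simpl in H0. pose proof (Cmod_ge_0 (l2 - l1)).
  assert (E : (l2 - l1)%C = 0) by (apply Cmod_eq_0; lra).
  replace l2 with (l2 - l1 + l1)%C by ring. rewrite E. ring.
Qed.

Lemma Clim_const l : Clim (fun _ => l) l.
Proof.
  apply Clim_squeeze with (fun _ => 0). 2: apply is_lim_seq_const.
  intros _. replace (l - l)%C with (RtoC 0) by ring. rewrite Cmod_0; lra.
Qed.

Lemma Clim_plus u v l m : Clim u l -> Clim v m -> Clim (fun n => u n + v n)%C (l + m)%C.
Proof.
  intros H1 H2. apply Clim_squeeze with (fun n => Cmod (u n - l) + Cmod (v n - m)).
  - intros n. replace (u n + v n - (l + m))%C with ((u n - l) + (v n - m))%C by ring.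
    apply Cmod_triangle.
  - replace 0 with (0 + 0) by ring. now apply is_lim_seq_plus'.
Qed.

Lemma Clim_scal a u l : Clim u l -> Clim (fun n => a * u n)%C (a * l)%C.
Proof.
  intros H. apply Clim_squeeze with (fun n => Cmod a * Cmod (u n - l)).
  - intros n. right. rewrite <- Cmod_mult. f_equal. ring.
  - replace (Finite 0) with (Rbar_mult (Cmod a) 0) by (simpl; f_equal; ring).
    now apply is_lim_seq_scal_l.
Qed.

Lemma Clim_incr u l : Clim u l <-> Clim (fun n => u (S n)) l.
Proof. exact (is_lim_seq_incr_1 (fun n => Cmod (u n - l)) 0). Qed.

Lemma Clim_Cmod_le u l B : (forall n, Cmod (u n) <= B) -> Clim u l -> Cmod l <= B.
Proof.
  intros HB H. apply Rnot_lt_le. intros Hlt.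
  destruct (proj1 (Clim_eps u l) H (Cmod l - B)) as [N HN]; [lra|].
  specialize (HN N (Nat.le_refl N)). specialize (HB N).
  assert (Cmod l <= Cmod (u N) + Cmod (u N - l)).
  { rewrite <- (Cmod_opp (u N - l)).
    replace l with (u N + - (u N - l))%C at 1 by ring. apply Cmod_triangle. }
  lra.
Qed.

Lemma Clim_bounded u l : Clim u l -> exists M, forall n, Cmod (u n) <= M.
Proof.
  intros H. destruct (proj1 (Clim_eps u l) H 1) as [N HN]; [lra|].
  assert (G : forall k, exists M, forall n, (n < k)%nat -> Cmod (u n) <= M).
  { induction k as [|k [M IH]]. exists 0; intros; lia.
    exists (Rmax M (Cmod (u k))). intros n Hn.
    destruct (Nat.eq_dec n k) as [->|]. apply Rmax_r.
    apply Rle_trans with (2 := Rmax_l _ _). apply IH; lia. }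
  destruct (G N) as [M HM]. exists (Rmax M (1 + Cmod l)). intros n.
  destruct (Nat.lt_ge_cases n N) as [Hn|Hn].
  - apply Rle_trans with (2 := Rmax_l _ _); auto.
  - apply Rle_trans with (2 := Rmax_r _ _). specialize (HN n Hn).
    pose proof (Cmod_triangle (u n - l) l) as T.
    replace (u n - l + l)%C with (u n) in T by ring. lra.
Qed.

Lemma csum_ext u v n : (forall k, (k < n)%nat -> u k = v k) -> csum u n = csum v n.
Proof.
  induction n; intros H; simpl; auto. rewrite IHn, H; auto.
Qed.

Lemma csum_plus u v n : csum (fun k => u k + v k)%C n = (csum u n + csum v n)%C.
Proof. induction n; simpl. ring. rewrite IHn. ring. Qed.

Lemma csum_scal a u n : csum (fun k => a * u k)%C n = (a * csum u n)%C.
Proof. induction n; simpl. ring. rewrite IHn. ring. Qed.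

Lemma csum_first u n : csum u (S n) = (u O + csum (fun k => u (S k)) n)%C.
Proof. induction n. simpl; ring. simpl in *. rewrite IHn. ring. Qed.

Lemma sum_n_csum (u : nat -> C) n :
  sum_n (G := C_AbelianMonoid) u n = csum u (S n).
Proof.
  induction n. rewrite sum_O. simpl. ring. rewrite sum_Sn, IHn. reflexivity.
Qed.

Lemma pow_n_Cpow (z : C) n : pow_n (K := C_Ring) z n = Cpow z n.
Proof. induction n; simpl. reflexivity. rewrite IHn. reflexivity. Qed.

Lemma sum_n_psum (c : nat -> C) z n :
  sum_n (G := C_AbelianMonoid) (fun k => scal (V := C_NormedModule) (pow_n (K := C_Ring) z k) (c k)) n
  = psum c z (S n).
Proof.
  rewrite sum_n_csum. apply csum_ext. intros k _. rewrite pow_n_Cpow.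
  unfold scal; simpl; unfold mult; simpl. ring.
Qed.


(** Partial sums are indexed differently on the two sides: [psum c z n] has n terms,
    while [sum_n] has n + 1. *)
Lemma is_pseries_series_at (c : nat -> C) (z l : C) :
  is_pseries (V := C_NormedModule) c z l <-> series_at c z l.
Proof.
  unfold series_at. rewrite Clim_incr, Clim_eps.
  unfold is_pseries, is_series.
  pose proof (@filterlim_locally_ball_norm C_AbsRing nat C_NormedModule eventually _
    (sum_n (fun k : nat => scal (pow_n (K := C_Ring) z k) (c k))) l) as E.
  split; intros H.
  - intros eps He. destruct (proj1 E H (mkposreal eps He)) as [N HN]. exists N. intros n Hn.
    rewrite <- sum_n_psum. exact (HN n Hn).
  - refine (proj2 E _). intros eps. destruct (H eps (cond_pos eps)) as [N HN]. exists N. intros n Hn.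
    specialize (HN n Hn). rewrite <- sum_n_psum in HN. exact HN.
Qed.

Lemma psum_0 c n : psum c 0 (S n) = c O.
Proof.
  induction n. unfold psum; simpl; ring.
  unfold psum in *. simpl in *. rewrite IHn. ring.
Qed.

Lemma series_at_0 c : series_at c 0 (c O).
Proof.
  unfold series_at. rewrite Clim_incr. apply Clim_ext with (fun _ => c O).
  intros; now rewrite psum_0. apply Clim_const.
Qed.

Lemma series_at_tail c (z l : C) :
  series_at (fun n => c (S n)) z l -> series_at c z (c O + z * l)%C.
Proof.
  unfold series_at. intros H. rewrite Clim_incr.
  apply Clim_ext with (fun n => c O + z * psum (fun n => c (S n)) z n)%C.
  - intros n. unfold psum. rewrite csum_first, <- csum_scal. simpl. f_equal. ring.
    apply csum_ext. intros; ring.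
  - apply Clim_plus. apply Clim_const. now apply Clim_scal.
Qed.

Lemma series_at_shift c (z l : C) : z <> RtoC 0 ->
  series_at c z l -> series_at (fun n => c (S n)) z ((l - c O) / z)%C.
Proof.
  unfold series_at. intros Hz H. rewrite Clim_incr in H.
  apply Clim_ext with (fun n => / z * (psum c z (S n) + - c O))%C.
  - intros n. unfold psum. rewrite csum_first.
    replace (csum (fun k => c (S k) * z ^ S k) n)%C
      with (z * csum (fun k => c (S k) * z ^ k) n)%C.
    simpl. field; auto.
    rewrite <- csum_scal. apply csum_ext. intros; simpl; ring.
  - replace ((l - c O) / z)%C with (/ z * (l + - c O))%C by (field; auto).
    apply Clim_scal, Clim_plus; auto using Clim_const.
Qed.

Lemma series_at_plus c e z l m :
  series_at c z l -> series_at e z m -> series_at (fun n => c n + e n)%C z (l + m)%C.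
Proof.
  intros H1 H2. unfold series_at, psum.
  apply Clim_ext with (fun n => psum c z n + psum e z n)%C.
  - intros n. unfold psum. rewrite <- csum_plus. apply csum_ext. intros; ring.
  - now apply Clim_plus.
Qed.

Lemma series_at_scal a c z l :
  series_at c z l -> series_at (fun n => a * c n)%C z (a * l)%C.
Proof.
  intros H1. unfold series_at, psum.
  apply Clim_ext with (fun n => a * psum c z n)%C.
  - intros n. unfold psum. rewrite <- csum_scal. apply csum_ext. intros; ring.
  - now apply Clim_scal.
Qed.

Lemma series_at_term_bounded c z l :
  series_at c z l -> exists M, 0 <= M /\ forall n, Cmod (c n) * Cmod z ^ n <= M.
Proof.
  intros H. destruct (Clim_bounded _ _ H) as [M HM].
  assert (0 <= M) by (apply Rle_trans with (2 := HM O); apply Cmod_ge_0).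
  exists (M + M). split; [lra|]. intros n.
  rewrite <- Cmod_pow, <- Cmod_mult.
  replace (c n * z ^ n)%C with (psum c z (S n) + - psum c z n)%C by (unfold psum; simpl; ring).
  eapply Rle_trans. apply Cmod_triangle. rewrite Cmod_opp. apply Rplus_le_compat; auto.
Qed.

Definition sums_on (R0 : R) (c : nat -> C) (f : C -> C) : Prop :=
  forall z, Cmod z < R0 -> series_at c z (f z).

(** Convergence at one point of modulus between r and R0 makes the terms bounded
    there, which is geometric decay of the coefficients. *)
Lemma sums_on_geometric R0 c f r : 0 <= r < R0 -> sums_on R0 c f ->
  exists M q, 0 <= M /\ 0 < q /\ q * r < 1 /\ forall n, Cmod (c n) <= M * q ^ n.
Proof.
  intros Hr H. set (p := (r + R0) / 2).
  assert (Hp : r < p < R0) by (unfold p; lra).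
  destruct (series_at_term_bounded c p (f p)) as [M [HM HB]].
  { apply H. rewrite Cmod_R, Rabs_pos_eq; lra. }
  rewrite Cmod_R, Rabs_pos_eq in HB by lra.
  exists M, (/ p). repeat split; auto.
  - apply Rinv_0_lt_compat; lra.
  - apply Rmult_lt_reg_l with p; [lra|]. field_simplify; lra.
  - intros n. rewrite pow_inv. apply Rmult_le_reg_r with (p ^ n).
    apply pow_lt; lra. rewrite Rmult_assoc, Rinv_l, Rmult_1_r; auto.
    apply pow_nonzero; lra.
Qed.


Lemma csum_Cmod_le u n : Cmod (csum u (S n)) <= sum_n (fun k => Cmod (u k)) n.
Proof.
  induction n.
  - rewrite sum_O. simpl. replace (0 + u O)%C with (u O) by ring. lra.
  - change (csum u (S (S n))) with (csum u (S n) + u (S n))%C. rewrite sum_Sn.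
    eapply Rle_trans. apply Cmod_triangle. unfold plus; simpl. simpl in IHn. lra.
Qed.

Lemma sum_n_le_series (x : nat -> R) l n :
  (forall k, 0 <= x k) -> is_series x l -> sum_n x n <= l.
Proof.
  intros Hx H.
  apply (is_lim_seq_le_loc (fun _ => sum_n x n) (sum_n x) (sum_n x n) l).
  - exists n. intros p Hp. induction Hp. lra. rewrite sum_Sn. unfold plus; simpl.
    specialize (Hx (S m)). lra.
  - apply is_lim_seq_const.
  - exact H.
Qed.

Lemma series_at_le c z l (x : nat -> R) s :
  (forall n, Cmod (c n) * Cmod z ^ n <= x n) -> is_series x s -> series_at c z l ->
  Cmod l <= s.
Proof.
  intros Hx Hs H.
  assert (H0 : forall n, 0 <= x n).
  { intros n. apply Rle_trans with (2 := Hx n).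
    apply Rmult_le_pos; [|apply pow_le]; apply Cmod_ge_0. }
  unfold series_at in H. rewrite Clim_incr in H. apply Clim_Cmod_le with (2 := H).
  intros n. unfold psum. eapply Rle_trans. apply csum_Cmod_le.
  apply Rle_trans with (sum_n x n). 2: now apply sum_n_le_series.
  apply sum_n_m_le. intros k. rewrite Cmod_mult, Cmod_pow. apply Hx.
Qed.

Lemma series_at_exists c z (x : nat -> R) :
  (forall n, Cmod (c n) * Cmod z ^ n <= x n) -> ex_series x -> exists l, series_at c z l.
Proof.
  intros Hx Hs.
  destruct (@ex_series_le C_AbsRing C_CompleteNormedModule
    (fun k => scal (V := C_NormedModule) (pow_n (K := C_Ring) z k) (c k)) x) as [l Hl].
  - intros n. apply Rle_trans with (2 := Hx n). right.
    change (Cmod (pow_n (K := C_Ring) z n * c n)%C = Cmod (c n) * Cmod z ^ n).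
    rewrite pow_n_Cpow, Cmod_mult, Cmod_pow. ring.
  - exact Hs.
  - exists l. apply is_pseries_series_at. exact Hl.
Qed.

Lemma is_series_scaled_geom M q : Rabs q < 1 -> is_series (fun n => M * q ^ n) (M / (1 - q)).
Proof.
  intros Hq. apply (is_series_scal_l (K := R_AbsRing) (V := R_NormedModule) M).
  now apply is_series_geom.
Qed.

(** The Cauchy square of the geometric series has n + 1 equal terms in degree n. *)
Lemma is_series_geom_deriv q : 0 <= q < 1 ->
  is_series (fun n => INR (S n) * q ^ n) (/ (1 - q) ^ 2).
Proof.
  intros Hq. replace (/ (1 - q) ^ 2) with (/ (1 - q) * / (1 - q)) by (field; lra).
  assert (G : is_series (fun n => q ^ n) (/ (1 - q))).
  { apply is_series_geom. rewrite Rabs_pos_eq; lra. }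
  apply is_series_ext with (fun n => sum_f_R0 (fun k => q ^ k * q ^ (n - k)) n).
  - intros n. rewrite <- (sum_eq (fun _ => q ^ n)).
    + rewrite sum_cte. apply Rmult_comm.
    + intros i Hi. rewrite <- pow_add. f_equal. lia.
  - apply is_series_mult_pos; auto; intros; apply pow_le; lra.
Qed.

(** * Iterated difference quotients *)

Definition near (z0 : C) (P : C -> Prop) : Prop :=
  exists r : R, 0 < r /\ forall z : C, Cmod (z - z0) < r -> P z.

(** The successive Caratheodory difference quotients of [f] at [z0] exist up to order
    k and the last one is locally bounded. Order 3 amounts to a second order Taylor
    expansion with a cubic error, which is all that the maximum principle uses, and
    unlike a local power series it passes to quotients by a short induction. *)
Fixpoint reg (k : nat) (f : C -> C) (z0 : C) : Prop :=
  match k with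
  | O => exists M : R, near z0 (fun z => Cmod (f z) <= M)
  | S j => exists f1 : C -> C,
      reg j f1 z0 /\ near z0 (fun z => f z = (f z0 + (z - z0) * f1 z)%C)
  end.

Lemma Cmod_refl (z : C) : Cmod (z - z) = 0.
Proof. replace (z - z)%C with (RtoC 0) by ring. apply Cmod_0. Qed.

Lemma Cmod_sub_sym (z w : C) : Cmod (z - w) = Cmod (w - z).
Proof. rewrite <- Cmod_opp. f_equal. ring. Qed.

Lemma Cmod_triangle_inv (z w : C) : Cmod z - Cmod w <= Cmod (z - w).
Proof.
  pose proof (Cmod_triangle (z - w) w) as H.
  replace (z - w + w)%C with z in H by ring. lra.
Qed.

Lemma Csub_neq (z w : C) : z <> w -> (z - w)%C <> RtoC 0.
Proof.
  intros H E. apply H. replace z with (z - w + w)%C by ring. rewrite E. ring.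
Qed.

Lemma near_and z0 P Q : near z0 P -> near z0 Q -> near z0 (fun z => P z /\ Q z).
Proof.
  intros [r [Hr HP]] [s [Hs HQ]]. exists (Rmin r s). split. now apply Rmin_pos.
  intros z Hz. split.
  - apply HP. eapply Rlt_le_trans. apply Hz. apply Rmin_l.
  - apply HQ. eapply Rlt_le_trans. apply Hz. apply Rmin_r.
Qed.

Lemma near_impl z0 (P Q : C -> Prop) : (forall z, P z -> Q z) -> near z0 P -> near z0 Q.
Proof. intros H [r [Hr HP]]. exists r; auto. Qed.

Lemma near_self z0 P : near z0 P -> P z0.
Proof. intros [r [Hr HP]]. apply HP. now rewrite Cmod_refl. Qed.

Lemma near_all z0 (P : C -> Prop) : (forall z, P z) -> near z0 P.
Proof. intros H. exists 1. split; [lra|auto]. Qed.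

Lemma near_disc R0 z0 : Cmod z0 < R0 -> near z0 (fun z => Cmod z < R0).
Proof.
  intros H. exists (R0 - Cmod z0). split; [lra|]. intros z Hz.
  pose proof (Cmod_triangle_inv z z0). lra.
Qed.

Lemma near_neq (z0 a : C) : z0 <> a -> near z0 (fun z => z <> a).
Proof.
  intros H. exists (Cmod (a - z0)). split.
  - apply Cmod_gt_0. apply Csub_neq. congruence.
  - intros z Hz ->. lra.
Qed.

Lemma reg_ext k : forall f g z0,
  near z0 (fun z => f z = g z) -> reg k f z0 -> reg k g z0.
Proof.
  destruct k; simpl; intros f g z0 E.
  - intros [M H]. exists M. apply near_impl with (2 := near_and _ _ _ E H).
    intros z [-> ?]; auto.
  - intros [f1 [H1 H]]. exists f1. split; auto. pose proof (near_self _ _ E) as E0.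
    apply near_impl with (2 := near_and _ _ _ E H). intros z [E1 E2].
    rewrite <- E1, <- E0. exact E2.
Qed.

(** If the difference quotient is bounded near z0 then so is f. *)
Lemma reg_pred k : forall f z0, reg (S k) f z0 -> reg k f z0.
Proof.
  induction k; intros f z0 [f1 [H1 H]].
  - destruct H1 as [M H1]. exists (Cmod (f z0) + M).
    assert (H2 : near z0 (fun z => Cmod (z - z0) < 1)) by (exists 1; split; [lra|auto]).
    apply near_impl with (2 := near_and _ _ _ H2 (near_and _ _ _ H H1)).
    intros z [A [-> B]]. eapply Rle_trans. apply Cmod_triangle. apply Rplus_le_compat_l.
    rewrite Cmod_mult. rewrite <- (Rmult_1_l M).
    apply Rmult_le_compat; auto using Cmod_ge_0; lra.
  - exists f1. split; auto.
Qed.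

Lemma reg_le j k f z0 : (j <= k)%nat -> reg k f z0 -> reg j f z0.
Proof. induction 1; auto. intros H1. apply IHle. now apply reg_pred. Qed.

Lemma reg_const k : forall (a z0 : C), reg k (fun _ => a) z0.
Proof.
  induction k; intros a z0; simpl.
  - exists (Cmod a). apply near_all; intros; lra.
  - exists (fun _ => RtoC 0). split; auto. apply near_all. intros; ring.
Qed.

Lemma reg_id k (z0 : C) : reg k (fun z => z) z0.
Proof.
  apply reg_pred. exists (fun _ => RtoC 1). split. apply reg_const.
  apply near_all. intros; ring.
Qed.

Lemma reg_plus k : forall f g z0, reg k f z0 -> reg k g z0 ->
  reg k (fun z => f z + g z)%C z0.
Proof.
  induction k; simpl; intros f g z0.
  - intros [M H] [N H']. exists (M + N).
    apply near_impl with (2 := near_and _ _ _ H H'). intros z [A B].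
    eapply Rle_trans. apply Cmod_triangle. lra.
  - intros [f1 [H1 H]] [g1 [H1' H']]. exists (fun z => f1 z + g1 z)%C. split; auto.
    apply near_impl with (2 := near_and _ _ _ H H'). intros z [-> ->]. ring.
Qed.

(** f g = f(z0) g(z0) + (z - z0) (f(z0) g1 + f1 g), where f1 and g1 are the difference
    quotients. *)
Lemma reg_mult k : forall f g z0, reg k f z0 -> reg k g z0 ->
  reg k (fun z => f z * g z)%C z0.
Proof.
  induction k; intros f g z0.
  - intros [M H] [N H']. exists (M * N).
    apply near_impl with (2 := near_and _ _ _ H H'). intros z [A B].
    rewrite Cmod_mult. apply Rmult_le_compat; auto using Cmod_ge_0.
  - intros Hf Hg. pose proof (reg_pred _ _ _ Hg) as Hg0. destruct Hf as [f1 [H1 H]], Hg as [g1 [H1' H']].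
    exists (fun z => f z0 * g1 z + f1 z * g z)%C. split.
    + apply reg_plus; apply IHk; auto. apply reg_const.
    + apply near_impl with (2 := near_and _ _ _ H H'). intros z [A ->].
      rewrite A. ring.
Qed.

Lemma reg_scal k a f z0 : reg k f z0 -> reg k (fun z => a * f z)%C z0.
Proof. intros H. apply reg_mult; auto. apply reg_const. Qed.

Lemma reg_minus k f g z0 : reg k f z0 -> reg k g z0 -> reg k (fun z => f z - g z)%C z0.
Proof.
  intros Hf Hg. apply reg_ext with (fun z => f z + RtoC (-1) * g z)%C.
  - apply near_all. intros; replace (RtoC (-1)) with (- RtoC 1)%C by now rewrite <- RtoC_opp. ring.
  - apply reg_plus; auto. now apply reg_scal.
Qed.

Lemma reg_pow k n z0 : reg k (fun z => z ^ n)%C z0.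
Proof.
  induction n; simpl. apply reg_const. apply reg_mult; auto. apply reg_id.
Qed.

Lemma reg_continuous f z0 : reg 1 f z0 ->
  forall eps, 0 < eps -> near z0 (fun z => Cmod (f z - f z0) < eps).
Proof.
  intros [f1 [[M H1] H]] eps He.
  assert (HM : 0 <= M) by (apply Rle_trans with (2 := near_self _ _ H1); apply Cmod_ge_0).
  assert (H2 : near z0 (fun z => Cmod (z - z0) < eps / (M + 1))).
  { exists (eps / (M + 1)). split; auto. apply Rdiv_lt_0_compat; lra. }
  apply near_impl with (2 := near_and _ _ _ H2 (near_and _ _ _ H H1)).
  intros z [A [-> B]].
  replace (f z0 + (z - z0) * f1 z - f z0)%C with ((z - z0) * f1 z)%C by ring.
  rewrite Cmod_mult. apply Rle_lt_trans with (eps / (M + 1) * M).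
  - apply Rmult_le_compat; auto using Cmod_ge_0; lra.
  - apply Rlt_le_trans with (eps / (M + 1) * (M + 1)).
    + apply Rmult_lt_compat_l; [|lra]. apply Rdiv_lt_0_compat; lra.
    + right. field. lra.
Qed.

Lemma reg_neq0 f z0 : reg 1 f z0 -> f z0 <> RtoC 0 ->
  near z0 (fun z => Cmod (f z0) / 2 <= Cmod (f z)).
Proof.
  intros H H0. apply Cmod_gt_0 in H0.
  apply near_impl with (2 := reg_continuous _ _ H (Cmod (f z0) / 2) ltac:(lra)).
  intros z Hz. rewrite Cmod_sub_sym in Hz. pose proof (Cmod_triangle_inv (f z0) (f z)). lra.
Qed.

(** The difference quotient of 1/f is - f1 / (f(z0) f), so each order of 1/f comes
    from the previous one; order 0 holds because f stays away from 0 near z0. *)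
Lemma reg_inv k : forall f z0, reg (S k) f z0 -> f z0 <> RtoC 0 ->
  reg (S k) (fun z => / f z)%C z0.
Proof.
  assert (B : forall f z0, reg 1 f z0 -> f z0 <> RtoC 0 -> reg 0 (fun z => / f z)%C z0).
  { intros f z0 H H0. exists (/ (Cmod (f z0) / 2)).
    pose proof (proj1 (Cmod_gt_0 _) H0) as H0'.
    apply near_impl with (2 := reg_neq0 _ _ H H0). intros z Hz.
    rewrite Cmod_inv. apply Rinv_le_contravar; lra. apply Cmod_gt_0. lra. }
  assert (S1 : forall k f z0, reg (S k) f z0 -> f z0 <> RtoC 0 ->
     reg k (fun z => / f z)%C z0 -> reg (S k) (fun z => / f z)%C z0).
  { intros j f z0 H H0 Hi.
    pose proof (reg_le 1 (S j) _ _ ltac:(lia) H) as Hc. destruct H as [f1 [H1 H]].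
    exists (fun z => - / f z0 * (f1 z * / f z))%C. split.
    - apply reg_scal, reg_mult; auto.
    - apply near_impl with (2 := near_and _ _ _ (reg_neq0 _ _ Hc H0) H).
      intros z [Hz E]. assert (f z <> RtoC 0).
      { apply Cmod_gt_0. apply Cmod_gt_0 in H0. lra. }
      assert (E1 : ((z - z0) * f1 z)%C = (f z - f z0)%C) by (rewrite E; ring).
      transitivity (/ f z0 - / f z0 * ((z - z0) * f1 z) * / f z)%C. 2: ring.
      rewrite E1. field; auto. }
  induction k; intros f z0 H H0; apply S1; auto using reg_pred.
Qed.

Lemma reg_div k f g z0 : reg (S k) f z0 -> reg (S k) g z0 -> g z0 <> RtoC 0 ->
  reg (S k) (fun z => f z / g z)%C z0.
Proof. intros. apply reg_mult; auto. apply reg_inv; auto. Qed.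

Lemma reg_comp_scal k (a : C) : forall f z0, reg k f (a * z0)%C -> reg k (fun z => f (a * z)%C) z0.
Proof.
  assert (N : forall P z0, near (a * z0)%C P -> near z0 (fun z => P (a * z)%C)).
  { intros P z0 [r [Hr HP]]. pose proof (Cmod_ge_0 a).
    exists (r / (Cmod a + 1)). split. apply Rdiv_lt_0_compat; lra.
    intros z Hz. apply HP. replace (a * z - a * z0)%C with (a * (z - z0))%C by ring.
    rewrite Cmod_mult. apply Rle_lt_trans with ((Cmod a) * (r / (Cmod a + 1))).
    - apply Rmult_le_compat_l; lra.
    - apply Rlt_le_trans with ((Cmod a + 1) * (r / (Cmod a + 1))).
      + apply Rmult_lt_compat_r; [|lra]. apply Rdiv_lt_0_compat; lra.
      + right; field; lra. }
  induction k; intros f z0; simpl.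
  - intros [M H]. exists M. apply N in H. exact H.
  - intros [f1 [H1 H]]. exists (fun z => a * f1 (a * z))%C. split.
    + apply reg_scal; auto.
    + apply N in H. apply near_impl with (2 := H). intros z ->. ring.
Qed.

Lemma reg_translate k (a : C) : forall f z0,
  reg k (fun z => f (a + z)%C) z0 -> reg k f (a + z0)%C.
Proof.
  assert (N : forall P z0, near z0 (fun z => P (a + z)%C) -> near (a + z0)%C P).
  { intros P z0 [r [Hr HP]]. exists r. split; auto. intros z Hz.
    replace z with (a + (z - a))%C by ring. apply HP.
    replace (z - a - z0)%C with (z - (a + z0))%C by ring. auto. }
  induction k; intros f z0; simpl.
  - intros [M H]. exists M. now apply N.
  - intros [f1 [H1 H]]. exists (fun z => f1 (z - a)%C). split.
    + apply IHk. apply reg_ext with (2 := H1). apply near_all. intros z. f_equal; ring.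
    + apply N. apply near_impl with (2 := H). intros z ->.
      replace (a + z - a)%C with z by ring. ring.
Qed.

(** [C_derive] takes a limit along horizontal increments, and any continuous
    difference quotient computes it. *)
Lemma reg_C_derive f f1 z0 : reg 1 f1 z0 ->
  near z0 (fun z => f z = (f z0 + (z - z0) * f1 z)%C) -> C_derive f z0 = f1 z0.
Proof.
  intros H1 H. unfold C_derive, C_lim.
  assert (K : forall eps, 0 < eps -> exists d, 0 < d /\ forall x, Rabs (x - fst z0) < d ->
     x <> fst z0 ->
     Cmod ((f (x, snd z0) - f z0) / ((x, snd z0) - z0) - f1 z0)%C < eps).
  { intros eps He.
    destruct (near_and _ _ _ H (reg_continuous _ _ H1 eps He)) as [d [Hd HH]].
    exists d. split; auto. intros x Hx Hne.
    assert (E0 : ((x, snd z0) - z0)%C = RtoC (x - fst z0)).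
    { destruct z0 as [p q]; apply injective_projections; simpl; ring. }
    assert (N0 : RtoC (x - fst z0) <> RtoC 0).
    { intros E. apply RtoC_inj in E. lra. }
    destruct (HH (x, snd z0)) as [A B].
    { rewrite E0, Cmod_R. auto. }
    rewrite A. rewrite E0 in *.
    replace ((f z0 + (x - fst z0)%R * f1 (x, snd z0) - f z0) / (x - fst z0)%R)%C
      with (f1 (x, snd z0)) by (field; auto). auto. }
  assert (L : forall (p : C -> R), (forall z w, p (z - w)%C = p z - p w) ->
     (forall z, Rabs (p z) <= Cmod z) ->
     Lim (fun x => p ((f (x, snd z0) - f z0) / ((x, snd z0) - z0))%C) (fst z0) = p (f1 z0)).
  { intros p Hp Hb. rewrite (is_lim_unique _ _ (Finite (p (f1 z0)))). reflexivity.
    apply is_lim_spec. simpl. intros eps. destruct (K eps (cond_pos eps)) as [d [Hd HK]].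
    exists (mkposreal d Hd). intros x Hx Hne. rewrite <- Hp.
    eapply Rle_lt_trans. apply Hb. apply HK; auto. }
  rewrite (L fst), (L snd); auto.
  - destruct (f1 z0); reflexivity.
  - intros z. apply Rle_trans with (2 := Rmax_Cmod z). apply Rmax_r.
  - intros z. apply Rle_trans with (2 := Rmax_Cmod z). apply Rmax_l.
Qed.

(** * Power series have difference quotients of every order *)

Lemma Cpow_0_l n : (RtoC 0 ^ S n)%C = RtoC 0.
Proof. simpl. ring. Qed.

Lemma dependent_sequence (P : nat -> C -> Prop) :
  (forall n, exists x, P n x) -> exists u, forall n, P n (u n).
Proof.
  intros H. exists (fun n => proj1_sig (constructive_indefinite_description _ (H n))).
  intros n. exact (proj2_sig (constructive_indefinite_description _ (H n))).
Qed.

Lemma Rabs_mult_lt_1 q r : 0 < q -> 0 <= r -> q * r < 1 -> Rabs (q * r) < 1.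
Proof. intros. rewrite Rabs_pos_eq; auto. apply Rmult_le_pos; lra. Qed.

Lemma is_lim_seq_scaled_0 B (v : nat -> R) : is_lim_seq v 0 -> is_lim_seq (fun n => B * v n) 0.
Proof.
  intros H. replace (Finite 0) with (Rbar_mult B 0) by (simpl; f_equal; ring).
  now apply is_lim_seq_scal_l.
Qed.

(** These are the coefficients, shifted by one index, of the difference quotient of
    the series c at z0, and they obey T j = c_j + z0 T (j+1). *)
Definition tails (c : nat -> C) (z0 : C) (T : nat -> C) : Prop :=
  forall j, series_at (fun m => c (j + m)%nat) z0 (T j).

Lemma tail_le c z0 T M q : 0 <= M -> 0 < q -> q * Cmod z0 < 1 ->
  (forall n, Cmod (c n) <= M * q ^ n) -> tails c z0 T ->
  forall j, Cmod (T j) <= M / (1 - q * Cmod z0) * q ^ j.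
Proof.
  intros HM Hq Hqz HB HT j. pose proof (Cmod_ge_0 z0) as Hz.
  apply (series_at_le _ _ _ (fun m => (M * q ^ j) * (q * Cmod z0) ^ m)) with (3 := HT j).
  - intros m. rewrite Rpow_mult_distr. apply Rle_trans with (M * q ^ (j + m) * Cmod z0 ^ m).
    + apply Rmult_le_compat_r; auto. apply pow_le; auto.
    + rewrite pow_add. right; ring.
  - replace (M / (1 - q * Cmod z0) * q ^ j) with ((M * q ^ j) / (1 - q * Cmod z0)) by (field; lra).
    apply is_series_scaled_geom. apply Rabs_mult_lt_1; auto.
Qed.

Lemma tails_exist R0 c f z0 : sums_on R0 c f -> Cmod z0 < R0 ->
  exists T, tails c z0 T /\ T O = f z0 /\ forall j, T j = (c j + z0 * T (S j))%C.
Proof.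
  intros H Hz. pose proof (Cmod_ge_0 z0) as Hz0.
  destruct (sums_on_geometric R0 c f (Cmod z0)) as [M [q [HM [Hq [Hqz HB]]]]]; auto.
  destruct (dependent_sequence (fun j x => series_at (fun m => c (j + m)%nat) z0 x)) as [T HT].
  { intros j. apply series_at_exists with (fun m => (M * q ^ j) * (q * Cmod z0) ^ m).
    - intros m. rewrite Rpow_mult_distr. apply Rle_trans with (M * q ^ (j + m) * Cmod z0 ^ m).
      + apply Rmult_le_compat_r; auto. apply pow_le; auto.
      + rewrite pow_add. right; ring.
    - eexists. apply is_series_scaled_geom. apply Rabs_mult_lt_1; auto. }
  exists T. split; [exact HT|split].
  - apply Clim_unique with (2 := H z0 Hz). exact (HT O).
  - intros j. apply Clim_unique with (1 := HT j).
    pose proof (series_at_tail (fun m => c (j + m)%nat) z0 (T (S j))) as E.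
    simpl in E. rewrite Nat.add_0_r in E. apply E.
    eapply Clim_ext. 2: apply (HT (S j)). intros n. apply csum_ext. intros k _.
    f_equal. f_equal. lia.
Qed.

(** A telescoping form of the factorization of f(z) - f(z0) by z - z0. *)
Lemma psum_tails c z0 T z n : (forall j, T j = (c j + z0 * T (S j))%C) ->
  ((z - z0) * psum (fun i => T (S i)) z n = psum c z n + T n * z ^ n - T O)%C.
Proof.
  intros HT. unfold psum. induction n; simpl. ring.
  rewrite Cmult_plus_distr_l, IHn. rewrite (HT n). ring.
Qed.

(** Summation by parts on the diagonal z = z0: it identifies the value at z0 of the
    difference quotient with the termwise derivative, and no double series has to be
    rearranged. *)
Lemma psum_tails_diag c z0 T n : (forall j, T j = (c j + z0 * T (S j))%C) ->
  (psum (fun i => RtoC (INR (S i)) * c (S i)) z0 n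
   = psum (fun i => T (S i)) z0 (S n) - RtoC (INR (S n)) * T (S n) * z0 ^ n)%C.
Proof.
  intros HT. induction n.
  - unfold psum; simpl. ring.
  - unfold psum in *. cbn [csum] in *. rewrite IHn. clear IHn.
    rewrite (HT (S n)). rewrite (S_INR (S n)), RtoC_plus. cbn [Cpow]. ring.
Qed.

(** A power series has at every point of its disc a difference quotient which is again
    a power series on that same disc (with coefficients [tails]), so no expansion has
    to be recentred. The last conclusion is termwise differentiation. *)
Lemma sums_on_slope R0 c f z0 : sums_on R0 c f -> Cmod z0 < R0 ->
  exists d f1, sums_on R0 d f1 /\
    (forall z, f z = (f z0 + (z - z0) * f1 z)%C) /\
    series_at (fun i => RtoC (INR (S i)) * c (S i))%C z0 (f1 z0).
Proof.
  intros H Hz. pose proof (Cmod_ge_0 z0) as Hz0.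
  destruct (tails_exist R0 c f z0 H Hz) as [T [HT [T0 HS]]].
  assert (G : forall r, Cmod z0 <= r < R0 -> exists B q, 0 <= B /\ 0 < q /\ q * r < 1 /\
    forall j, Cmod (T j) <= B * q ^ j).
  { intros r Hr. destruct (sums_on_geometric R0 c f r) as [M [q [HM [Hq [Hqr HB]]]]]; auto. lra.
    assert (Hqz : q * Cmod z0 < 1).
    { apply Rle_lt_trans with (2 := Hqr). apply Rmult_le_compat_l; lra. }
    exists (M / (1 - q * Cmod z0)), q. repeat split; auto.
    - apply Rmult_le_pos; auto. apply Rlt_le, Rinv_0_lt_compat; lra.
    - apply tail_le with c; auto. }
  assert (D : exists l, series_at (fun i => T (S i)) z0 l).
  { destruct (G (Cmod z0)) as [B [q [HB [Hq [Hqz HT']]]]]. lra.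
    apply series_at_exists with (fun m => (B * q) * (q * Cmod z0) ^ m).
    - intros m. rewrite Rpow_mult_distr. apply Rle_trans with (B * q ^ (S m) * Cmod z0 ^ m).
      + apply Rmult_le_compat_r; auto. apply pow_le; auto.
      + simpl. right; ring.
    - eexists. apply is_series_scaled_geom. apply Rabs_mult_lt_1; auto. }
  destruct D as [l Hl].
  exists (fun i => T (S i)),
    (fun z => if excluded_middle_informative (z = z0) then l else ((f z - f z0) / (z - z0))%C).
  split; [|split].
  - intros z Hzz. destruct (excluded_middle_informative (z = z0)) as [->|Hne]; auto.
    apply Csub_neq in Hne.
    destruct (G (Rmax (Cmod z0) (Cmod z))) as [B [q [HB [Hq [Hqr HT']]]]].
    { split. apply Rmax_l. apply Rmax_lub_lt; auto. }
    assert (Hqz : q * Cmod z < 1).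
    { apply Rle_lt_trans with (2 := Hqr). apply Rmult_le_compat_l. lra. apply Rmax_r. }
    apply Clim_ext with (fun n => / (z - z0) * ((psum c z n + T n * z ^ n) + - T O))%C.
    { intros n. replace (psum c z n + T n * z ^ n + - T O)%C
        with ((z - z0) * psum (fun i => T (S i)) z n)%C.
      field; auto. rewrite (psum_tails c) by auto. ring. }
    replace ((f z - f z0) / (z - z0))%C with (/ (z - z0) * ((f z + 0) + - T O))%C
      by (rewrite T0; field; auto).
    apply Clim_scal, Clim_plus. 2: apply Clim_const. apply Clim_plus. now apply H.
    apply Clim_squeeze with (fun n => B * (q * Cmod z) ^ n).
    + intros n. replace (T n * z ^ n - 0)%C with (T n * z ^ n)%C by ring.
      rewrite Cmod_mult, Cmod_pow, Rpow_mult_distr, <- Rmult_assoc.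
      apply Rmult_le_compat_r; auto. apply pow_le, Cmod_ge_0.
    + apply is_lim_seq_scaled_0, is_lim_seq_geom, Rabs_mult_lt_1; auto using Cmod_ge_0.
  - intros z. destruct (excluded_middle_informative (z = z0)) as [->|Hne]. ring.
    apply Csub_neq in Hne. field; auto.
  - destruct (excluded_middle_informative (z0 = z0)) as [_|]; [|tauto].
    destruct (G (Cmod z0)) as [B [q [HB [Hq [Hqz HT']]]]]. lra.
    apply Clim_ext with (fun n => psum (fun i => T (S i)) z0 (S n)
       + RtoC (-1) * (RtoC (INR (S n)) * T (S n) * z0 ^ n))%C.
    { intros n. rewrite (psum_tails_diag c z0 T) by auto.
      replace (RtoC (-1)) with (- RtoC 1)%C by now rewrite <- RtoC_opp. ring. }
    replace l with (l + RtoC (-1) * 0)%C by ring.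
    apply Clim_plus. apply (proj1 (Clim_incr _ _)). exact Hl.
    apply Clim_scal.
    apply Clim_squeeze with (fun n => (B * q) * (INR (S n) * (q * Cmod z0) ^ n)).
    + intros n.
      replace (RtoC (INR (S n)) * T (S n) * z0 ^ n - 0)%C
        with (RtoC (INR (S n)) * T (S n) * z0 ^ n)%C by ring.
      rewrite !Cmod_mult, Cmod_pow, Cmod_R, Rabs_pos_eq, Rpow_mult_distr by apply pos_INR.
      specialize (HT' (S n)). simpl pow in HT'.
      apply Rle_trans with (INR (S n) * (B * (q * q ^ n)) * Cmod z0 ^ n).
      * apply Rmult_le_compat_r. apply pow_le; auto.
        apply Rmult_le_compat_l; auto. apply pos_INR.
      * right; ring.
    + apply is_lim_seq_scaled_0.
      apply (ex_series_lim_0 (fun n => INR (S n) * (q * Cmod z0) ^ n)).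
      eexists. apply is_series_geom_deriv. split; auto. apply Rmult_le_pos; lra.
Qed.

Lemma reg_sums_on k : forall R0 c f z0, sums_on R0 c f -> Cmod z0 < R0 -> reg k f z0.
Proof.
  induction k; intros R0 c f z0 H Hz.
  - pose proof (Cmod_ge_0 z0).
    destruct (sums_on_geometric R0 c f ((Cmod z0 + R0) / 2)) as [M [q [HM [Hq [Hqr HB]]]]]; auto. lra.
    exists (M / (1 - q * ((Cmod z0 + R0) / 2))).
    apply near_impl with (2 := near_disc ((Cmod z0 + R0) / 2) z0 ltac:(lra)).
    intros z Hzz. pose proof (Cmod_ge_0 z).
    apply (series_at_le c z (f z) (fun n => M * (q * ((Cmod z0 + R0) / 2)) ^ n)).
    + intros n. rewrite Rpow_mult_distr, <- Rmult_assoc.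
      apply Rmult_le_compat; auto using Cmod_ge_0. apply pow_le; lra.
      apply pow_incr; lra.
    + apply is_series_scaled_geom, Rabs_mult_lt_1; auto. lra.
    + apply H; lra.
  - destruct (sums_on_slope R0 c f z0 H Hz) as [d [f1 [H1 [E _]]]].
    exists f1. split. eapply IHk; eauto. now apply near_all.
Qed.

Lemma C_derive_sums_on R0 c f z0 : sums_on R0 c f -> Cmod z0 < R0 ->
  series_at (fun i => RtoC (INR (S i)) * c (S i))%C z0 (C_derive f z0).
Proof.
  intros H Hz. destruct (sums_on_slope R0 c f z0 H Hz) as [d [f1 [H1 [E S1]]]].
  rewrite (reg_C_derive f f1 z0); auto.
  - eapply reg_sums_on; eauto.
  - now apply near_all.
Qed.

Lemma analytic_on_local_series U f z0 : analytic_on U f -> U z0 ->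
  exists R0 c, 0 < R0 /\ sums_on R0 c (fun z => f (z0 + z)%C).
Proof.
  intros H HU. destruct (H z0 HU) as [c [eps Hc]].
  exists eps, c. split. apply cond_pos. intros z Hz.
  apply is_pseries_series_at.
  replace z with ((z0 + z) - z0)%C at 1 by ring. apply Hc.
  apply C_NormedModule_mixin_compat1.
  replace (minus (z0 + z)%C z0) with z; auto.
  unfold minus, plus, opp; simpl. ring.
Qed.

Lemma reg_analytic_on k U f z0 : analytic_on U f -> U z0 -> reg k f z0.
Proof.
  intros H HU. destruct (analytic_on_local_series U f z0 H HU) as [R0 [c [HR Hc]]].
  replace z0 with (z0 + 0)%C by ring. apply reg_translate.
  apply reg_sums_on with R0 c; auto. rewrite Cmod_0. auto.
Qed.

(** * The maximum modulus principle *)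

(** Compactness of the closed disc in the form of a Lebesgue number: a property of
    scales that holds locally at some scale holds everywhere at one common scale. *)
Lemma disc_compact (a : C) (rho : R) (A : R -> C -> Prop) :
  (forall d e z, d <= e -> A e z -> A d z) ->
  (forall p, Cmod (p - a) <= rho -> exists d, 0 < d /\
     forall z, Cmod (z - a) <= rho -> Cmod (z - p) < d -> A d z) ->
  exists d, 0 < d /\ forall z, Cmod (z - a) <= rho -> A d z.
Proof.
  intros Hanti Hloc.
  assert (D : forall x y : R, exists d : posreal, forall z, Cmod (z - a) <= rho ->
     Rabs (fst z - x) < d -> Rabs (snd z - y) < d -> A d z).
  { intros x y.
    assert (B : forall (z : C) d, Rabs (fst z - x) < d -> Rabs (snd z - y) < d ->
       Cmod (z - (x, y)) < 2 * d).
    { intros z d Hx Hy. eapply Rle_lt_trans. apply Cmod_2Rmax. simpl.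
      assert (sqrt 2 <= 2).
      { rewrite <- (sqrt_pow2 2) at 2 by lra. apply sqrt_le_1; lra. }
      apply Rle_lt_trans with (2 * Rmax (Rabs (fst z + - x)) (Rabs (snd z + - y))).
      - apply Rmult_le_compat_r; auto. apply Rle_trans with (2 := Rmax_l _ _). apply Rabs_pos.
      - apply Rmult_lt_compat_l; [lra|]. apply Rmax_lub_lt; auto. }
    destruct (Rle_lt_dec (Cmod ((x, y) - a)) rho) as [H|H].
    - destruct (Hloc (x, y) H) as [d [Hd HA]].
      assert (Hd2 : 0 < d / 2) by lra. exists (mkposreal _ Hd2). simpl. intros z Hz Hx Hy.
      apply Hanti with d; [lra|]. apply HA; auto.
      specialize (B z _ Hx Hy). lra.
    - assert (Hd2 : 0 < (Cmod ((x, y) - a) - rho) / 2) by lra.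
      exists (mkposreal _ Hd2). simpl. intros z Hz Hx Hy. exfalso.
      specialize (B z _ Hx Hy).
      pose proof (Cmod_triangle_inv ((x, y) - a) (z - a)) as T.
      replace ((x, y) - a - (z - a))%C with ((x, y) - z)%C in T by ring.
      rewrite (Cmod_sub_sym (x, y) z) in T. lra. }
  pose (delta := fun x y => proj1_sig (constructive_indefinite_description _ (D x y))).
  destruct (compactness_value_2d (fst a - rho) (fst a + rho) (snd a - rho) (snd a + rho) delta)
    as [d Hd].
  exists d. split. apply cond_pos. intros z Hz. apply NNPP. intros HN.
  pose proof (Rmax_Cmod (z - a)%C) as HM. simpl in HM.
  pose proof (Rle_trans _ _ _ (Rmax_l _ _) (Rle_trans _ _ _ HM Hz)) as H1.
  pose proof (Rle_trans _ _ _ (Rmax_r _ _) (Rle_trans _ _ _ HM Hz)) as H2.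
  apply Rabs_le_between in H1. apply Rabs_le_between in H2.
  apply (Hd (fst z) (snd z)); [lra|lra|].
  intros [x [y [_ [_ [Hx [Hy Hdd]]]]]]. apply HN. apply Hanti with (delta x y); auto.
  unfold delta in *.
  destruct (constructive_indefinite_description _ (D x y)) as [d0 H0]. simpl in *. auto.
Qed.

(** Compactness is used twice: to bound u, then to keep u away from a supremum that it
    would never reach. *)
Lemma disc_argmax (u : C -> R) (a : C) (rho : R) : 0 <= rho ->
  (forall p, Cmod (p - a) <= rho -> forall eps, 0 < eps -> near p (fun z => Rabs (u z - u p) < eps)) ->
  exists p, Cmod (p - a) <= rho /\ forall z, Cmod (z - a) <= rho -> u z <= u p.
Proof.
  intros Hrho Hc.
  destruct (disc_compact a rho (fun d z => 0 < d -> u z <= / d)) as [b [Hb HB]].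
  { intros d e z Hde H Hd. apply Rle_trans with (/ e). apply H; lra.
    apply Rinv_le_contravar; lra. }
  { intros p Hp. destruct (Hc p Hp 1) as [r [Hr H]]; [lra|].
    pose proof (Rabs_pos (u p)).
    assert (Hi : 0 < / (Rabs (u p) + 1)) by (apply Rinv_0_lt_compat; lra).
    exists (Rmin r (/ (Rabs (u p) + 1))). split. apply Rmin_pos; auto.
    intros z _ Hz Hd. apply Rle_trans with (Rabs (u p) + 1).
    - specialize (H z (Rlt_le_trans _ _ _ Hz (Rmin_l _ _))). apply Rabs_def2 in H.
      pose proof (Rle_abs (u p)). lra.
    - rewrite <- (Rinv_inv (Rabs (u p) + 1)) at 1. apply Rinv_le_contravar; auto. apply Rmin_r. }
  destruct (completeness (fun y => exists z, Cmod (z - a) <= rho /\ y = u z)) as [S [HU HL]].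
  { exists (/ b). intros y [z [Hz ->]]. auto. }
  { exists (u a). exists a. rewrite Cmod_refl. auto. }
  assert (HS : forall z, Cmod (z - a) <= rho -> u z <= S) by (intros z Hz; apply HU; eauto).
  apply NNPP. intros HN.
  assert (Hlt : forall p, Cmod (p - a) <= rho -> u p < S).
  { intros p Hp. destruct (Rle_lt_or_eq_dec _ _ (HS p Hp)) as [|E]; auto.
    exfalso. apply HN. exists p. split; auto. rewrite E. auto. }
  destruct (disc_compact a rho (fun d z => u z <= S - d)) as [d [Hd HD]].
  { intros; lra. }
  { intros p Hp. specialize (Hlt p Hp).
    destruct (Hc p Hp ((S - u p) / 2)) as [r [Hr H]]; [lra|].
    exists (Rmin r ((S - u p) / 2)). split. apply Rmin_pos; lra.
    intros z _ Hz. specialize (H z (Rlt_le_trans _ _ _ Hz (Rmin_l _ _))). apply Rabs_def2 in H.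
    pose proof (Rmin_r r ((S - u p) / 2)). lra. }
  assert (S <= S - d); [|lra]. apply HL. intros y [z [Hz ->]]. auto.
Qed.

Lemma Cmod_sqr (z : C) : Cmod z ^ 2 = fst z * fst z + snd z * snd z.
Proof. rewrite Cmod2_alt. unfold Re, Im. ring. Qed.

(** The average of f over the four points p + s, with s = r, -r, ir, -ir, is f(p) up
    to an error of order r^3, because the first and second order terms cancel. So the
    average of |f|^2 is at least |f(p)|^2 minus a cubic term, while the average of eps
    |z - a|^2 gains eps r^2: the sum is larger than its central value at one of the
    four points. *)
Lemma four_point_mean (f : C -> C) (p a : C) (eps : R) : reg 3 f p -> 0 < eps ->
  exists r0, 0 < r0 /\ forall r, 0 < r < r0 -> exists s, Cmod s = r /\
    Cmod (f p) ^ 2 + eps * Cmod (p - a) ^ 2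
    < Cmod (f (p + s)%C) ^ 2 + eps * Cmod (p + s - a) ^ 2.
Proof.
  intros [f1 [[f2 [[f3 [[M H3] H2]] H1]] H0]] He.
  assert (HM : 0 <= M) by (apply Rle_trans with (2 := near_self _ _ H3); apply Cmod_ge_0).
  destruct (near_and _ _ _ H3 (near_and _ _ _ H2 (near_and _ _ _ H1 H0))) as [r1 [Hr1 HH]].
  clear H0 H1 H2 H3.
  set (A := Cmod (f p)). assert (HA : 0 <= A) by apply Cmod_ge_0.
  (* For such r the gain 4 eps r^2 beats the error 8 |f(p)| M r^3. *)
  exists (Rmin r1 (eps / (4 * A * M + 1))).
  assert (HAM : 0 <= A * M) by (apply Rmult_le_pos; auto).
  split. { apply Rmin_pos; auto. apply Rdiv_lt_0_compat; lra. }
  intros r [Hr Hr2].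
  assert (Hrr1 : r < r1) by (eapply Rlt_le_trans; [apply Hr2|apply Rmin_l]).
  assert (Hre : r * (4 * A * M + 1) < eps).
  { apply Rlt_le_trans with (eps / (4 * A * M + 1) * (4 * A * M + 1)).
    - apply Rmult_lt_compat_r; [lra|]. eapply Rlt_le_trans; [apply Hr2|apply Rmin_r].
    - right; field; lra. }
  assert (K : forall s, Cmod s = r -> exists e, Cmod e <= r ^ 3 * M /\
     f (p + s)%C = (f p + s * f1 p + s * s * f2 p + e)%C).
  { intros s Hs. exists (s * s * s * f3 (p + s))%C.
    destruct (HH (p + s)%C) as [B [E2 [E1 E0]]].
    { replace (p + s - p)%C with s by ring. lra. }
    split.
    - rewrite !Cmod_mult, Hs. apply Rle_trans with (r * r * r * M).
      + apply Rmult_le_compat_l; auto. repeat apply Rmult_le_pos; lra.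
      + right; ring.
    - rewrite E0, E1, E2. ring. }
  apply NNPP. intros HN.
  assert (HN' : forall s, Cmod s = r -> 
     Cmod (f (p + s)%C) ^ 2 + eps * Cmod (p + s - a) ^ 2 <= Cmod (f p) ^ 2 + eps * Cmod (p - a) ^ 2).
  { intros s Hs. apply Rnot_lt_le. intros Hlt. apply HN. eauto. }
  assert (S1 : Cmod (RtoC r) = r) by (rewrite Cmod_R, Rabs_pos_eq; lra).
  assert (S2 : Cmod (- RtoC r) = r) by (rewrite Cmod_opp; auto).
  assert (S3 : Cmod (Ci * RtoC r) = r) by (rewrite Cmod_mult, Cmod_Ci; lra).
  assert (S4 : Cmod (- (Ci * RtoC r)) = r) by (rewrite Cmod_opp; auto).
  destruct (K _ S1) as [e1 [B1 E1]]. destruct (K _ S2) as [e2 [B2 E2]].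
  destruct (K _ S3) as [e3 [B3 E3]]. destruct (K _ S4) as [e4 [B4 E4]].
  apply HN' in S1, S2, S3, S4.
  pose proof (Rmax_Cmod e1) as C1. pose proof (Rmax_Cmod e2) as C2.
  pose proof (Rmax_Cmod e3) as C3. pose proof (Rmax_Cmod e4) as C4.
  assert (SE : forall e, Cmod e <= r ^ 3 * M ->
      - (A * (r ^ 3 * M)) <= fst (f p) * fst e + snd (f p) * snd e).
  { intros e Hb. replace (fst (f p) * fst e + snd (f p) * snd e) with (Re (f p * Cconj e)%C)
      by (unfold Re; simpl; ring).
    pose proof (re_le_Cmod (f p * Cconj e)%C) as T. rewrite Cmod_mult, Cmod_conj in T.
    apply Rabs_le_between in T. fold A in T.
    assert (A * Cmod e <= A * (r ^ 3 * M)) by (apply Rmult_le_compat_l; auto). lra. }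
  pose proof (SE _ B1) as D1. pose proof (SE _ B2) as D2.
  pose proof (SE _ B3) as D3. pose proof (SE _ B4) as D4.
  clear SE HN HN' K HH C1 C2 C3 C4 B1 B2 B3 B4 Hr2 Hrr1.
  assert (Q : forall w : C, 2 * (fst (f p) * fst w + snd (f p) * snd w) - A ^ 2 <= Cmod w ^ 2).
  { intros w. unfold A. rewrite !Cmod_sqr.
    pose proof (Rle_0_sqr (fst w - fst (f p))). pose proof (Rle_0_sqr (snd w - snd (f p))).
    unfold Rsqr in *. lra. }
  pose proof (Q (f (p + r)%C)) as Q1. pose proof (Q (f (p + - r)%C)) as Q2.
  pose proof (Q (f (p + Ci * r)%C)) as Q3. pose proof (Q (f (p + - (Ci * r))%C)) as Q4.
  clear Q. fold A in S1, S2, S3, S4.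
  assert (HA2 : A ^ 2 = fst (f p) * fst (f p) + snd (f p) * snd (f p)) by apply Cmod_sqr.
  assert (G : 4 * A ^ 2 - 8 * (A * (r ^ 3 * M)) <=
     Cmod (f (p + r)%C) ^ 2 + Cmod (f (p + - r)%C) ^ 2
     + Cmod (f (p + Ci * r)%C) ^ 2 + Cmod (f (p + - (Ci * r))%C) ^ 2).
  { eapply Rle_trans; [|repeat apply Rplus_le_compat; eassumption].
    rewrite E1, E2, E3, E4. simpl. simpl in HA2. lra. }
  assert (P : Cmod (p + r - a) ^ 2 + Cmod (p + - r - a) ^ 2
     + Cmod (p + Ci * r - a) ^ 2 + Cmod (p + - (Ci * r) - a) ^ 2 = 4 * Cmod (p - a) ^ 2 + 4 * r ^ 2).
  { rewrite !Cmod_sqr. simpl. ring. }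
  assert (eps * (4 * Cmod (p - a) ^ 2 + 4 * r ^ 2) + (4 * A ^ 2 - 8 * (A * (r ^ 3 * M)))
    <= 4 * (A ^ 2 + eps * Cmod (p - a) ^ 2)) by (rewrite <- P; lra).
  assert (0 < r ^ 2) by (apply pow_lt; auto).
  assert (r ^ 2 * (r * (4 * A * M + 1)) < r ^ 2 * eps) by (apply Rmult_lt_compat_l; auto).
  assert (0 <= r ^ 2 * r) by (apply Rmult_le_pos; lra).
  assert (0 <= (r ^ 2 * r) * (A * M)) by (apply Rmult_le_pos; lra).
  simpl in *. lra.
Qed.

(** By [four_point_mean], |f|^2 + eps |z - a|^2 has its maximum over the disc on the
    circle, for every eps > 0. *)
Lemma maximum_modulus (f : C -> C) (a : C) (rho M : R) : 0 <= rho -> 0 <= M ->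
  (forall z, Cmod (z - a) <= rho -> reg 3 f z) ->
  (forall z, Cmod (z - a) = rho -> Cmod (f z) <= M) -> Cmod (f a) <= M.
Proof.
  intros Hrho HM Hreg HB. apply Rnot_lt_le. intros Hlt.
  assert (Hsq : M ^ 2 < Cmod (f a) ^ 2) by (simpl; nra).
  (* Small enough that M^2 + eps rho^2 stays below |f(a)|^2. *)
  set (eps := (Cmod (f a) ^ 2 - M ^ 2) / (rho ^ 2 + 1)).
  assert (Hr2 : 0 <= rho ^ 2) by (apply pow_le; auto).
  assert (He : 0 < eps) by (apply Rdiv_lt_0_compat; lra).
  assert (Hee : eps * (rho ^ 2 + 1) = Cmod (f a) ^ 2 - M ^ 2) by (unfold eps; field; lra).
  destruct (disc_argmax (fun z => Cmod (f z) ^ 2 + eps * Cmod (z - a) ^ 2) a rho Hrho)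
    as [p [Hp Hmax]].
  { intros p Hp e0 He0.
    assert (Cont : forall (g : C -> C) w, reg 1 g w -> forall e, 0 < e ->
       near w (fun z => Rabs (Cmod (g z) ^ 2 - Cmod (g w) ^ 2) < e)).
    { intros g w Hg e He1. pose proof (Cmod_ge_0 (g w)).
      assert (Hd : 0 < Rmin 1 (e / (2 * Cmod (g w) + 2))).
      { apply Rmin_pos. lra. apply Rdiv_lt_0_compat; lra. }
      apply near_impl with (2 := reg_continuous g w Hg _ Hd). intros z Hz.
      pose proof (Rlt_le_trans _ _ _ Hz (Rmin_l _ _)) as Z1.
      pose proof (Rlt_le_trans _ _ _ Hz (Rmin_r _ _)) as Z2.
      pose proof (Cmod_triangle_inv (g z) (g w)) as T1.
      pose proof (Cmod_triangle_inv (g w) (g z)) as T2. rewrite (Cmod_sub_sym (g w)) in T2.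
      pose proof (Cmod_ge_0 (g z)).
      assert (Z3 : Cmod (g z - g w) * (2 * Cmod (g w) + 2) < e).
      { apply Rlt_le_trans with (e / (2 * Cmod (g w) + 2) * (2 * Cmod (g w) + 2)).
        apply Rmult_lt_compat_r; lra. right; field; lra. }
      pose proof (Cmod_ge_0 (g z - g w)%C).
      replace (Cmod (g z) ^ 2 - Cmod (g w) ^ 2)
        with ((Cmod (g z) - Cmod (g w)) * (Cmod (g z) + Cmod (g w))) by ring.
      rewrite Rabs_mult, (Rabs_pos_eq (Cmod (g z) + Cmod (g w))) by lra.
      apply Rle_lt_trans with (2 := Z3).
      apply Rmult_le_compat; try apply Rabs_pos; try lra.
      apply Rabs_le; lra. }
    assert (R1 : reg 1 f p) by (apply reg_le with 3%nat; auto).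
    assert (R2 : reg 1 (fun z => z - a)%C p) by (apply reg_minus; [apply reg_id|apply reg_const]).
    assert (He2 : 0 < e0 / 2 / eps) by (repeat apply Rdiv_lt_0_compat; lra).
    apply near_impl with (2 := near_and _ _ _ (Cont _ _ R1 (e0 / 2) ltac:(lra)) (Cont _ _ R2 _ He2)).
    intros z [A B].
    apply Rmult_lt_compat_l with (r := eps) in B; auto.
    replace (eps * (e0 / 2 / eps)) with (e0 / 2) in B by (field; lra).
    rewrite <- (Rabs_pos_eq eps) in B at 1 by lra. rewrite <- Rabs_mult in B.
    replace (Cmod (f z) ^ 2 + eps * Cmod (z - a) ^ 2 - (Cmod (f p) ^ 2 + eps * Cmod (p - a) ^ 2))
      with ((Cmod (f z) ^ 2 - Cmod (f p) ^ 2) + eps * (Cmod (z - a) ^ 2 - Cmod (p - a) ^ 2)) by ring.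
    eapply Rle_lt_trans. apply Rabs_triang. lra. }
  destruct (Rle_lt_or_eq_dec _ _ Hp) as [Hin|Hbd].
  - destruct (four_point_mean f p a eps (Hreg p Hp) He) as [r0 [Hr0 HF]].
    set (r := Rmin (r0 / 2) (rho - Cmod (p - a))).
    assert (0 < r) by (apply Rmin_pos; lra).
    pose proof (Rmin_l (r0 / 2) (rho - Cmod (p - a))) as L1.
    pose proof (Rmin_r (r0 / 2) (rho - Cmod (p - a))) as L2. fold r in L1, L2.
    destruct (HF r) as [s [Hs HF']]; [lra|].
    assert (Cmod (p + s - a) <= rho).
    { replace (p + s - a)%C with ((p - a) + s)%C by ring.
      eapply Rle_trans. apply Cmod_triangle. lra. }
    specialize (Hmax _ H0). simpl in *. lra.
  - assert (Ha : Cmod (a - a) <= rho) by (rewrite Cmod_refl; auto).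
    specialize (Hmax a Ha). specialize (HB p Hbd). simpl in Hmax.
    rewrite Cmod_refl, Hbd in Hmax.
    pose proof (Cmod_ge_0 (f p)).
    assert (Cmod (f p) * Cmod (f p) <= M * M) by (apply Rmult_le_compat; auto).
    simpl in *. lra.
Qed.

(** * Coefficient bounds from averages over roots of unity *)

Lemma bernoulli_sub n t : 0 <= t <= 1 -> 1 - INR n * t <= (1 - t) ^ n.
Proof.
  intros Ht. induction n. simpl; lra.
  rewrite S_INR. simpl. pose proof (pos_INR n).
  assert ((1 - t) * (1 - INR n * t) <= (1 - t) * (1 - t) ^ n) by (apply Rmult_le_compat_l; lra).
  assert (0 <= INR n * t * t) by (repeat apply Rmult_le_pos; lra). lra.
Qed.

(** The maximum principle on the circle of radius 1 - t gives |Q(0)| <= M / (1 - t)^n;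
    let t tend to 0. *)
Lemma schwarz_order (Q : C -> C) n M : 0 <= M ->
  (forall z, Cmod z < 1 -> reg 3 Q z) ->
  (forall z, Cmod z < 1 -> Cmod z ^ n * Cmod (Q z) <= M) -> Cmod (Q 0) <= M.
Proof.
  intros HM Hreg HB.
  assert (K : forall t, 0 < t < 1 -> (1 - INR n * t) * Cmod (Q 0) <= M).
  { intros t Ht. assert (Hp : 0 < (1 - t) ^ n) by (apply pow_lt; lra).
    pose proof (Cmod_ge_0 (Q 0)).
    apply Rle_trans with ((1 - t) ^ n * Cmod (Q 0)).
    { apply Rmult_le_compat_r; auto. apply bernoulli_sub; lra. }
    assert (Cmod (Q 0) <= M / (1 - t) ^ n).
    { apply (maximum_modulus Q 0 (1 - t)); [lra| | |].
      - apply Rmult_le_pos; auto. apply Rlt_le, Rinv_0_lt_compat; auto.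
      - intros z Hz. replace (z - 0)%C with z in Hz by ring. apply Hreg. lra.
      - intros z Hz. replace (z - 0)%C with z in Hz by ring.
        apply Rmult_le_reg_l with ((1 - t) ^ n); auto.
        replace ((1 - t) ^ n * (M / (1 - t) ^ n)) with M by (field; lra).
        rewrite <- Hz. apply HB. lra. }
    apply Rle_trans with ((1 - t) ^ n * (M / (1 - t) ^ n)).
    - apply Rmult_le_compat_l; lra.
    - right; field; lra. }
  apply Rnot_lt_le. intros Hlt. pose proof (pos_INR n).
  set (q := Cmod (Q 0)) in *.
  set (t := Rmin (1 / 2) ((q - M) / (2 * (INR n * q + 1)))).
  assert (0 <= INR n * q) by (apply Rmult_le_pos; lra).
  assert (Ht : 0 < t) by (apply Rmin_pos; [lra|apply Rdiv_lt_0_compat; lra]).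
  pose proof (Rmin_l (1 / 2) ((q - M) / (2 * (INR n * q + 1)))) as L1.
  pose proof (Rmin_r (1 / 2) ((q - M) / (2 * (INR n * q + 1)))) as L2. fold t in L1, L2.
  specialize (K t ltac:(lra)).
  assert (t * (INR n * q + 1) <= (q - M) / 2).
  { apply Rle_trans with ((q - M) / (2 * (INR n * q + 1)) * (INR n * q + 1)).
    apply Rmult_le_compat_r; lra. right; field; lra. }
  lra.
Qed.

Definition unit_root (n : nat) : C :=
  (cos (2 * PI / INR n), sin (2 * PI / INR n)).

Lemma Cpow_trig t k : (((cos t, sin t) : C) ^ k)%C = (cos (INR k * t), sin (INR k * t)).
Proof.
  induction k.
  - simpl. rewrite Rmult_0_l, cos_0, sin_0. reflexivity.
  - rewrite Cpow_S, IHk, S_INR, Rmult_plus_distr_r, Rmult_1_l, cos_plus, sin_plus.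
    apply injective_projections; simpl; ring.
Qed.

Lemma Cmod_unit_root n : Cmod (unit_root n) = 1.
Proof.
  unfold Cmod, unit_root. simpl fst; simpl snd. rewrite <- sqrt_1. f_equal.
  rewrite <- (sin2_cos2 (2 * PI / INR n)). unfold Rsqr. ring.
Qed.

Lemma unit_root_pow n : (1 <= n)%nat -> (unit_root n ^ n)%C = 1.
Proof.
  intros Hn. apply le_INR in Hn. simpl in Hn. unfold unit_root. rewrite Cpow_trig.
  replace (INR n * (2 * PI / INR n)) with (2 * PI) by (field; lra).
  rewrite cos_2PI, sin_2PI. reflexivity.
Qed.

Lemma unit_root_pow_neq n k : (0 < k < n)%nat -> (unit_root n ^ k)%C <> 1.
Proof.
  intros [Hk Hn] E. apply lt_INR in Hk, Hn. simpl in Hk. unfold unit_root in E.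
  rewrite Cpow_trig in E. apply (f_equal fst) in E. simpl in E.
  pose proof PI_RGT_0 as HPI.
  assert (H1 : 0 < INR k / INR n < 1).
  { split. apply Rdiv_lt_0_compat; lra. apply Rmult_lt_reg_r with (INR n); [lra|].
    unfold Rdiv. rewrite Rmult_assoc, Rinv_l; lra. }
  replace (INR k * (2 * PI / INR n)) with (2 * (PI * (INR k / INR n))) in E by (field; lra).
  rewrite cos_2a_sin in E.
  assert (0 < sin (PI * (INR k / INR n))).
  { apply sin_gt_0. apply Rmult_lt_0_compat; lra.
    apply Rlt_le_trans with (PI * 1). apply Rmult_lt_compat_l; lra. lra. }
  apply (Rmult_lt_0_compat _ _ H) in H. lra.
Qed.

Lemma csum_geometric (w : C) n : ((w - 1) * csum (fun j => w ^ j) n = w ^ n - 1)%C.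
Proof.
  induction n; simpl. ring. rewrite Cmult_plus_distr_l, IHn. ring.
Qed.

Lemma csum_unit_root_pow n k : (0 < k < n)%nat -> csum (fun j => (unit_root n ^ j) ^ k)%C n = 0.
Proof.
  intros H. pose proof (csum_geometric (unit_root n ^ k) n) as G.
  rewrite <- Cpow_mult_r, Nat.mul_comm, Cpow_mult_r, unit_root_pow, Cpow_1_l in G by lia.
  rewrite (csum_ext _ (fun j => (unit_root n ^ k) ^ j)%C).
  2: { intros j _. rewrite <- !Cpow_mult_r, Nat.mul_comm. reflexivity. }
  set (S := csum _ n) in *.
  pose proof (Csub_neq _ _ (unit_root_pow_neq n k H)) as N.
  replace S with (/ (unit_root n ^ k - 1) * ((unit_root n ^ k - 1) * S))%C by (field; auto).
  rewrite G. ring.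
Qed.

Lemma csum_const (a : C) n : csum (fun _ => a) n = (RtoC (INR n) * a)%C.
Proof.
  induction n. simpl; ring. rewrite S_INR, RtoC_plus. cbn [csum]. rewrite IHn. ring.
Qed.

Lemma csum_swap (u : nat -> nat -> C) n m :
  csum (fun j => csum (fun k => u j k) m) n = csum (fun k => csum (fun j => u j k) n) m.
Proof.
  induction n; simpl.
  - induction m; simpl; auto. rewrite <- IHm. ring.
  - rewrite IHn, <- csum_plus. reflexivity.
Qed.

(** The successive shifts F 0, F 1, ... of a function by its Taylor coefficients at 0.
    This replaces a power series expansion for functions, such as g'/h', whose
    expansion is not known in advance to converge on the whole disc. *)
Definition tower (F : nat -> C -> C) (c : nat -> C) : Prop :=
  forall j z, Cmod z < 1 -> reg 3 (F j) z /\ F j z = (c j + z * F (S j) z)%C.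

Lemma tower_0 F c j : tower F c -> F j (RtoC 0) = c j.
Proof.
  intros H. destruct (H j (RtoC 0)) as [_ E]. rewrite Cmod_0; lra. rewrite E. ring.
Qed.

Lemma taylor_expand (F : nat -> C -> C) c n (z : C) :
  (forall j, F j z = (c j + z * F (S j) z)%C) -> F O z = (psum c z n + z ^ n * F n z)%C.
Proof.
  intros H. unfold psum. induction n; simpl. ring.
  rewrite IHn, (H n). ring.
Qed.

Lemma tower_expand F c n z : tower F c -> Cmod z < 1 ->
  F O z = (psum c z n + z ^ n * F n z)%C.
Proof. intros H Hz. apply taylor_expand. intros j. now apply H. Qed.

Lemma tower_scal a F c : tower F c -> tower (fun j z => a * F j z)%C (fun j => a * c j)%C.
Proof.
  intros H j z Hz. destruct (H j z Hz) as [R E]. split. now apply reg_scal.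
  rewrite E. ring.
Qed.

Lemma Cmod_unit_root_pow_mult n j z : Cmod (unit_root n ^ j * z) = Cmod z.
Proof. rewrite Cmod_mult, Cmod_pow, Cmod_unit_root, pow1. ring. Qed.

(** Averaging over the rotations by n-th roots of unity kills the coefficients c_1,
    ..., c_(n-1). *)
Lemma wiener_average F c n : tower F c -> (1 <= n)%nat ->
  exists B, (forall z, Cmod z < 1 -> reg 3 B z) /\ B (RtoC 0) = c n /\
    forall z, Cmod z < 1 ->
      (c O + z ^ n * B z = / INR n * csum (fun j => F O (unit_root n ^ j * z)) n)%C.
Proof.
  intros H Hn. assert (Hn0 : RtoC (INR n) <> RtoC 0).
  { intros E. apply RtoC_inj in E. apply le_INR in Hn. simpl in Hn. lra. }
  exists (fun z => / INR n * csum (fun j => F n (unit_root n ^ j * z)) n)%C.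
  split; [|split].
  - intros z Hz. apply reg_scal.
    assert (G : forall m, reg 3 (fun z => csum (fun j => F n (unit_root n ^ j * z)%C) m) z).
    { induction m; simpl csum. apply reg_const. apply reg_plus; auto.
      apply reg_comp_scal. apply H. now rewrite Cmod_unit_root_pow_mult. }
    apply G.
  - rewrite (csum_ext _ (fun _ => c n)), csum_const. field; auto.
    intros j _. replace (unit_root n ^ j * 0)%C with (RtoC 0) by ring. eapply tower_0; eauto.
  - intros z Hz.
    rewrite (csum_ext (fun j => F O (unit_root n ^ j * z)%C)
      (fun j => csum (fun k => c k * (unit_root n ^ j * z) ^ k)%C n
                + z ^ n * F n (unit_root n ^ j * z))%C).
    2: { intros j _. rewrite (tower_expand F c n) by (auto; now rewrite Cmod_unit_root_pow_mult).
      unfold psum. f_equal. rewrite Cpow_mult_l, <- Cpow_mult_r, Nat.mul_comm, Cpow_mult_r,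
        unit_root_pow, Cpow_1_l by auto. ring. }
    rewrite csum_plus, csum_scal, csum_swap.
    destruct n as [|n]; [lia|].
    pose (G := fun k => csum (fun j => c k * (unit_root (S n) ^ j * z) ^ k)%C (S n)).
    change (csum (fun k => csum (fun j => c k * (unit_root (S n) ^ j * z) ^ k)%C (S n)) (S n))
      with (csum G (S n)).
    assert (G0 : G O = (RtoC (INR (S n)) * c O)%C).
    { unfold G. rewrite <- csum_const. apply csum_ext. intros; simpl; ring. }
    assert (GS : forall k, (k < n)%nat -> G (S k) = RtoC 0).
    { intros k Hk. unfold G.
      rewrite (csum_ext _ (fun j => (c (S k) * z ^ S k) * (unit_root (S n) ^ j) ^ S k)%C).
      - rewrite csum_scal, csum_unit_root_pow by lia. ring.
      - intros j _. rewrite Cpow_mult_l. ring. }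
    rewrite (csum_first G), (csum_ext (fun k => G (S k)) (fun _ => RtoC 0)) by auto.
    rewrite csum_const, G0. field; auto.
Qed.

Lemma csum_fst_le u n d : (forall j, fst (u j) <= d) -> fst (csum u n) <= INR n * d.
Proof.
  intros H. induction n. simpl; lra. rewrite S_INR. simpl. specialize (H n). lra.
Qed.

Lemma csum_Cmod_le_const u n d : (forall j, Cmod (u j) <= d) -> Cmod (csum u n) <= INR n * d.
Proof.
  intros H. induction n. simpl. rewrite Cmod_0; lra. rewrite S_INR. simpl csum.
  eapply Rle_trans. apply Cmod_triangle. specialize (H n). lra.
Qed.

Lemma Cmod_le_of_sqr z w : Cmod z ^ 2 <= Cmod w ^ 2 -> Cmod z <= Cmod w.
Proof.
  intros H. pose proof (Cmod_ge_0 z). pose proof (Cmod_ge_0 w). simpl in H. nra.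
Qed.

Lemma Cmod_RtoC_inv_INR n : (1 <= n)%nat -> Cmod (/ INR n) = / INR n.
Proof.
  intros Hn. apply le_INR in Hn. simpl in Hn.
  rewrite <- RtoC_inv by lra. rewrite Cmod_R, Rabs_pos_eq; auto. apply Rlt_le, Rinv_0_lt_compat; lra.
Qed.

(** With A = c_0 + z^n B the average of f, the Moebius image (A - c_0)/(1 - conj(c_0)
    A) has modulus at most 1; dividing it by z^n and evaluating at 0 leaves c_n/(1 -
    |c_0|^2). *)
Lemma bounded_coefficient_le F c n : tower F c ->
  (forall z, Cmod z < 1 -> Cmod (F O z) < 1) -> (1 <= n)%nat ->
  Cmod (c n) <= 1 - Cmod (c O) ^ 2.
Proof.
  intros H HF Hn. destruct (wiener_average F c n H Hn) as [B [HB [B0 HA]]].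
  set (A := fun z => (c O + z ^ n * B z)%C).
  assert (Hc0 : Cmod (c O) < 1).
  { rewrite <- (tower_0 F c O H). apply HF. rewrite Cmod_0; lra. }
  pose proof (Cmod_ge_0 (c O)) as Hc0'.
  assert (HA1 : forall z, Cmod z < 1 -> Cmod (A z) <= 1).
  { intros z Hz. unfold A. rewrite HA, Cmod_mult, Cmod_RtoC_inv_INR by auto.
    pose proof (le_INR _ _ Hn) as Hn'. simpl in Hn'.
    apply Rle_trans with (/ INR n * (INR n * 1)).
    - apply Rmult_le_compat_l. apply Rlt_le, Rinv_0_lt_compat; lra.
      apply csum_Cmod_le_const. intros j. apply Rlt_le, HF. now rewrite Cmod_unit_root_pow_mult.
    - right; field; lra. }
  assert (HD : forall z, Cmod z < 1 -> (1 - Cconj (c O) * A z)%C <> RtoC 0).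
  { intros z Hz E. apply Cmod_gt_0 with (2 := E). specialize (HA1 z Hz). clear E.
    pose proof (Cmod_triangle_inv 1 (Cconj (c O) * A z)) as T.
    rewrite Cmod_1, Cmod_mult, Cmod_conj in T. pose proof (Cmod_ge_0 (A z)). nra. }
  assert (HQ : Cmod (B (RtoC 0) / (1 - Cconj (c O) * A (RtoC 0))) <= 1).
  { apply (schwarz_order (fun z => B z / (1 - Cconj (c O) * A z))%C n); [lra| |].
    - intros z Hz. apply reg_div; auto. apply reg_minus. apply reg_const.
      apply reg_scal. unfold A. apply reg_plus. apply reg_const.
      apply reg_mult; auto. apply reg_pow.
    - intros z Hz. specialize (HD z Hz). rewrite Cmod_div, <- Cmod_pow by auto.
      unfold Rdiv. rewrite <- Rmult_assoc, <- Cmod_mult.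
      apply Cmod_gt_0 in HD. apply Rmult_le_reg_r with (Cmod (1 - Cconj (c O) * A z)); auto.
      rewrite Rmult_assoc, Rinv_l, Rmult_1_r, Rmult_1_l by lra.
      apply Cmod_le_of_sqr.
      replace (z ^ n * B z)%C with (A z - c O)%C by (unfold A; ring).
      specialize (HA1 z Hz). pose proof (Cmod_ge_0 (A z)).
      assert (0 <= (1 - Cmod (c O) ^ 2) * (1 - Cmod (A z) ^ 2)) by (apply Rmult_le_pos; simpl; nra).
      rewrite !Cmod_sqr in *. simpl in *. lra. }
  specialize (HD (RtoC 0) ltac:(rewrite Cmod_0; lra)).
  assert (A0 : A (RtoC 0) = c O).
  { unfold A. destruct n; [lia|]. rewrite Cpow_0_l. ring. }
  rewrite A0, B0 in *. rewrite Cmod_div in HQ by auto.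
  assert (E : Cmod (1 - Cconj (c O) * c O) = 1 - Cmod (c O) ^ 2).
  { replace (1 - Cconj (c O) * c O)%C with (RtoC (1 - Cmod (c O) ^ 2)).
    - rewrite Cmod_R, Rabs_pos_eq; auto. simpl; nra.
    - rewrite RtoC_minus, Cmod2_conj. ring. }
  rewrite E in HQ. assert (0 < 1 - Cmod (c O) ^ 2) by (simpl; nra).
  apply Rmult_le_compat_r with (r := 1 - Cmod (c O) ^ 2) in HQ; [|lra].
  unfold Rdiv in HQ. rewrite Rmult_assoc, Rinv_l in HQ; lra.
Qed.

(** Caratheodory's inequality. With A = z^n B the average of f, A lies in the
    half-plane Re <= d, so A/(2d - A) has modulus at most 1; dividing it by z^n and
    evaluating at 0 leaves c_n/(2d). *)
Lemma half_plane_coefficient_le F c n d : tower F c -> c O = RtoC 0 -> 0 < d ->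
  (forall z, Cmod z < 1 -> fst (F O z) <= d) -> (1 <= n)%nat ->
  Cmod (c n) <= 2 * d.
Proof.
  intros H Hc0 Hd HF Hn. destruct (wiener_average F c n H Hn) as [B [HB [B0 HA]]].
  set (A := fun z => (z ^ n * B z)%C).
  assert (HA1 : forall z, Cmod z < 1 -> fst (A z) <= d).
  { intros z Hz. unfold A. specialize (HA z Hz). rewrite Hc0, Cplus_0_l in HA. rewrite HA.
    pose proof (le_INR _ _ Hn) as Hn'. simpl in Hn'.
    rewrite <- RtoC_inv by lra.
    replace (fst (RtoC (/ INR n) * csum (fun j => F O (unit_root n ^ j * z)%C) n)%C)
      with (/ INR n * fst (csum (fun j => F O (unit_root n ^ j * z)%C) n)) by (simpl; ring).
    apply Rle_trans with (/ INR n * (INR n * d)).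
    - apply Rmult_le_compat_l. apply Rlt_le, Rinv_0_lt_compat; lra.
      apply csum_fst_le. intros j. apply HF. now rewrite Cmod_unit_root_pow_mult.
    - right; field; lra. }
  assert (HD : forall z, Cmod z < 1 -> (RtoC (2 * d) - A z)%C <> RtoC 0).
  { intros z Hz E. apply (f_equal fst) in E. specialize (HA1 z Hz). simpl in *. lra. }
  assert (HQ : Cmod (B (RtoC 0) / (RtoC (2 * d) - A (RtoC 0))) <= 1).
  { apply (schwarz_order (fun z => B z / (RtoC (2 * d) - A z))%C n); [lra| |].
    - intros z Hz. apply reg_div; auto. apply reg_minus. apply reg_const.
      unfold A. apply reg_mult; auto. apply reg_pow.
    - intros z Hz. specialize (HD z Hz). rewrite Cmod_div, <- Cmod_pow by auto.
      unfold Rdiv. rewrite <- Rmult_assoc, <- Cmod_mult.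
      apply Cmod_gt_0 in HD. apply Rmult_le_reg_r with (Cmod (RtoC (2 * d) - A z)); auto.
      rewrite Rmult_assoc, Rinv_l, Rmult_1_r, Rmult_1_l by lra.
      apply Cmod_le_of_sqr. fold (A z).
      specialize (HA1 z Hz).
      assert (0 <= d * (d - fst (A z))) by (apply Rmult_le_pos; lra).
      rewrite !Cmod_sqr. simpl in *. lra. }
  assert (A0 : A (RtoC 0) = RtoC 0).
  { unfold A. destruct n; [lia|]. rewrite Cpow_0_l. ring. }
  specialize (HD (RtoC 0) ltac:(rewrite Cmod_0; lra)).
  rewrite A0, B0 in *. rewrite Cmod_div in HQ by auto.
  replace (RtoC (2 * d) - 0)%C with (RtoC (2 * d)) in HQ by ring.
  rewrite Cmod_R, Rabs_pos_eq in HQ by lra.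
  apply Rmult_le_compat_r with (r := 2 * d) in HQ; [|lra].
  unfold Rdiv in HQ. rewrite Rmult_assoc, Rinv_l in HQ; lra.
Qed.

Lemma sums_on_tower R0 c f : 0 < R0 -> sums_on R0 c f ->
  exists F : nat -> C -> C, F O = f /\ (forall j, sums_on R0 (fun n => c (j + n)%nat) (F j)) /\
    forall j z, Cmod z < R0 -> F j z = (c j + z * F (S j) z)%C.
Proof.
  intros HR H.
  pose (F := fix F (j : nat) : C -> C := match j with
    | O => f
    | S i => fun z => if excluded_middle_informative (z = RtoC 0) then c j
                      else ((F i z - c i) / z)%C end).
  assert (HF : forall j, sums_on R0 (fun n => c (j + n)%nat) (F j)).
  { induction j; intros z Hz; [exact (H z Hz)|].
    simpl. destruct (excluded_middle_informative (z = RtoC 0)) as [->|Hne].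
    - pose proof (series_at_0 (fun n => c (S (j + n)))) as G. simpl in G.
      rewrite Nat.add_0_r in G. exact G.
    - pose proof (series_at_shift _ _ _ Hne (IHj z Hz)) as G. simpl in G.
      rewrite Nat.add_0_r in G. eapply Clim_ext; [|exact G].
      intros n. apply csum_ext. intros k _. do 2 f_equal. lia. }
  exists F. split; [reflexivity|]. split; auto.
  intros j z Hz. simpl. destruct (excluded_middle_informative (z = RtoC 0)) as [->|Hne].
  - replace (c j + 0 * c (S j))%C with (c j) by ring.
    apply Clim_unique with (1 := HF j (RtoC 0) Hz).
    pose proof (series_at_0 (fun n => c (j + n)%nat)) as G. simpl in G.
    rewrite Nat.add_0_r in G. exact G.
  - field; auto.
Qed.

Lemma power_series_tower c f : sums_on 1 c f -> exists F, F O = f /\ tower F c.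
Proof.
  intros H. destruct (sums_on_tower 1 c f Rlt_0_1 H) as [F [F0 [HF E]]].
  exists F. split; auto. intros j z Hz. split; auto. eapply reg_sums_on; eauto.
Qed.

(** * An injective analytic function on the disc omits a value *)

(** Compactness of the circle, taken from that of the disc by letting the property be
    vacuous off the circle. *)
Lemma circle_separated (f : C -> C) (a : C) (r : R) :
  (forall z, Cmod (z - a) <= r -> reg 1 f z) ->
  (forall z, Cmod (z - a) = r -> f z <> f a) ->
  exists d, 0 < d /\ forall z, Cmod (z - a) = r -> d <= Cmod (f z - f a).
Proof.
  intros Hreg Hne.
  destruct (disc_compact a r (fun d z => Cmod (z - a) = r -> d <= Cmod (f z - f a)))
    as [d [Hd HD]].
  - intros d e z Hde H Hz. specialize (H Hz). lra.
  - intros p Hp. destruct (Rle_lt_or_eq_dec _ _ Hp) as [Hlt|Heq].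
    + exists (r - Cmod (p - a)). split; [lra|]. intros z _ Hz Hr. exfalso.
      pose proof (Cmod_triangle_inv (z - a) (p - a)) as T.
      replace (z - a - (p - a))%C with (z - p)%C in T by ring. lra.
    + assert (R1 : reg 1 (fun z => f z - f a)%C p) by (apply reg_minus; [auto|apply reg_const]).
      pose proof (Csub_neq _ _ (Hne p Heq)) as Hn.
      destruct (reg_neq0 _ _ R1 Hn) as [e [He HH]].
      apply Cmod_gt_0 in Hn.
      exists (Rmin e (Cmod (f p - f a) / 2)). split. apply Rmin_pos; lra.
      intros z _ Hz _. eapply Rle_trans. apply Rmin_r. apply HH.
      eapply Rlt_le_trans. apply Hz. apply Rmin_l.
  - exists d. split; auto. intros z Hz. apply HD; lra.
Qed.

(** If w near f(a) were omitted, 1/(f - w) would be larger at a than on the circle. *)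
Lemma open_mapping (f : C -> C) (a : C) (r : R) : 0 < r ->
  (forall z, Cmod (z - a) <= r -> reg 3 f z) ->
  (forall z, Cmod (z - a) = r -> f z <> f a) ->
  exists d, 0 < d /\ forall w, Cmod (w - f a) < d -> exists z, Cmod (z - a) <= r /\ f z = w.
Proof.
  intros Hr Hreg Hne.
  destruct (circle_separated f a r) as [d [Hd HD]]; auto.
  { intros z Hz. apply reg_le with 3%nat; auto. }
  exists (d / 2). split; [lra|]. intros w Hw. apply NNPP. intros HN.
  assert (Hfw : forall z, Cmod (z - a) <= r -> (f z - w)%C <> RtoC 0).
  { intros z Hz. apply Csub_neq. intros E. apply HN. eauto. }
  assert (Ha : Cmod (a - a) <= r) by (rewrite Cmod_refl; lra).
  pose proof (Hfw a Ha) as H0.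
  assert (HM : Cmod (/ (f a - w)) <= / (d / 2)).
  { apply (maximum_modulus (fun z => / (f z - w))%C a r); [lra| | |].
    - apply Rlt_le, Rinv_0_lt_compat; lra.
    - intros z Hz. apply reg_inv; auto. apply reg_minus; auto. apply reg_const.
    - intros z Hz. rewrite Cmod_inv by (apply Hfw; lra). apply Rinv_le_contravar; [lra|].
      pose proof (Cmod_triangle_inv (f z - f a) (w - f a)) as T.
      replace (f z - f a - (w - f a))%C with (f z - w)%C in T by ring.
      specialize (HD z Hz). lra. }
  rewrite Cmod_inv in HM by auto. rewrite Cmod_sub_sym in Hw.
  apply Cmod_gt_0 in H0.
  assert (/ (d / 2) < / Cmod (f a - w)) by (apply Rinv_lt_contravar; auto; apply Rmult_lt_0_compat; lra).
  lra.
Qed.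

(** By injectivity the preimage provided by [open_mapping] is the value of the
    inverse. *)
Lemma analytic_inverse_continuous (phi psi : C -> C) :
  analytic_on unit_disc phi -> univalent_on unit_disc phi ->
  (forall w, unit_disc (psi w) /\ phi (psi w) = w) ->
  forall w eps, 0 < eps -> near w (fun v => Cmod (psi v - psi w) < eps).
Proof.
  intros Ha Hu Hpsi w eps He. destruct (Hpsi w) as [Hz Hw]. unfold unit_disc in Hz.
  set (a := psi w) in *. set (r := Rmin (eps / 2) ((1 - Cmod a) / 2)).
  assert (Hr : 0 < r) by (apply Rmin_pos; lra).
  pose proof (Rmin_l (eps / 2) ((1 - Cmod a) / 2)) as L1.
  pose proof (Rmin_r (eps / 2) ((1 - Cmod a) / 2)) as L2. fold r in L1, L2.
  assert (Hin : forall z, Cmod (z - a) <= r -> unit_disc z).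
  { intros z Hzr. unfold unit_disc. pose proof (Cmod_triangle_inv z a). lra. }
  destruct (open_mapping phi a r Hr) as [d [Hd HD]].
  - intros z Hzr. eapply reg_analytic_on; eauto.
  - intros z Hzr E. apply Hu in E; auto.
    + rewrite E, Cmod_refl in Hzr. lra.
    + apply Hin. lra.
  - exists d. split; auto. intros v Hv. rewrite <- Hw in Hv. destruct (HD v Hv) as [z [Hzr E]].
    replace (psi v) with z. lra. apply Hu; auto. apply Hpsi. rewrite E. symmetry. apply Hpsi.
Qed.

Lemma least_nat (P : nat -> Prop) : (exists n, P n) ->
  exists n, P n /\ forall m, (m < n)%nat -> ~ P m.
Proof.
  intros [n Hn]. revert Hn. induction n as [n IH] using (well_founded_induction Wf_nat.lt_wf).
  intros Hn. destruct (classic (exists m, (m < n)%nat /\ P m)) as [[m [Hm HP]]|H].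
  - now apply (IH m).
  - exists n. split; auto. intros m Hm HP. apply H. eauto.
Qed.

(** The first nonzero coefficient after c_0 exists, for otherwise phi would be
    constant near 0. *)
Lemma univalent_order (phi : C -> C) : analytic_on unit_disc phi -> univalent_on unit_disc phi ->
  exists k B, (1 <= k)%nat /\ reg 3 B (RtoC 0) /\ B (RtoC 0) <> RtoC 0 /\
    near (RtoC 0) (fun z => phi z = (phi (RtoC 0) + z ^ k * B z)%C).
Proof.
  intros Ha Hu. assert (D0 : unit_disc (RtoC 0)) by (unfold unit_disc; rewrite Cmod_0; lra).
  destruct (analytic_on_local_series unit_disc phi 0 Ha D0) as [R0 [c [HR Hc]]].
  assert (Hc' : sums_on R0 c phi).
  { intros z Hz. specialize (Hc z Hz). cbn beta in Hc. rewrite Cplus_0_l in Hc. exact Hc. }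
  clear Hc. destruct (sums_on_tower R0 c phi HR Hc') as [F [F0 [HF HE]]].
  assert (Fz : forall j, F j (RtoC 0) = c j).
  { intros j. rewrite HE by (rewrite Cmod_0; auto). ring. }
  assert (Hp0 : phi (RtoC 0) = c O) by (rewrite <- F0; auto).
  destruct (least_nat (fun k => c (S k) <> RtoC 0)) as [k [Hk Hmin]].
  { apply NNPP. intros HN.
    assert (Hz : forall j, c (S j) = RtoC 0).
    { intros j. apply NNPP. intros Hj. apply HN. eauto. }
    set (t := Rmin (1 / 2) (R0 / 2)).
    assert (Ht : 0 < t) by (apply Rmin_pos; lra).
    pose proof (Rmin_l (1 / 2) (R0 / 2)) as L1. pose proof (Rmin_r (1 / 2) (R0 / 2)) as L2.
    fold t in L1, L2.
    assert (Ct : Cmod t = t) by (rewrite Cmod_R, Rabs_pos_eq; lra).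
    assert (E : phi (RtoC t) = phi (RtoC 0)).
    { rewrite Hp0. apply Clim_unique with (psum c t). apply Hc'. lra.
      rewrite Clim_incr. apply Clim_ext with (fun _ => c O). 2: apply Clim_const.
      intros n. unfold psum. rewrite csum_first, (csum_ext _ (fun _ => RtoC 0)).
      rewrite csum_const. simpl; ring. intros j _. rewrite Hz. ring. }
    apply Hu in E; auto. apply RtoC_inj in E. lra. unfold unit_disc. lra. }
  exists (S k), (F (S k)). split; [lia|]. split; [|split].
  - eapply reg_sums_on. apply HF. rewrite Cmod_0; auto.
  - rewrite Fz. auto.
  - exists R0. split; auto. intros z Hz. replace (z - 0)%C with z in Hz by ring.
    transitivity (F O z). now rewrite F0. rewrite (taylor_expand F c (S k) z) by auto.
    f_equal. unfold psum. rewrite csum_first, (csum_ext _ (fun _ => RtoC 0)).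
    rewrite csum_const, Hp0. simpl; ring. intros j Hj.
    rewrite (NNPP _ (Hmin j Hj)). ring.
Qed.

(** Were phi onto, the inverse psi would be continuous, hence |psi| would reach a
    maximum below 1 over each closed disc: |phi - phi(0)| is at least M on some circle
    of radius rho < 1. The maximum principle bounds z^k/(phi - phi(0)) at 0 by 1/M,
    while its value there is 1/B(0), and M was taken to exceed |B(0)|. *)
Lemma univalent_not_onto (phi : C -> C) : analytic_on unit_disc phi -> univalent_on unit_disc phi ->
  exists q, ~ image phi unit_disc q.
Proof.
  intros Ha Hu. apply NNPP. intros HN.
  assert (Hsurj : forall w, exists z, unit_disc z /\ phi z = w).
  { intros w. apply NNPP. intros H. apply HN. exists w. exact H. }
  assert (D0 : unit_disc (RtoC 0)) by (unfold unit_disc; rewrite Cmod_0; lra).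
  set (psi := fun w => proj1_sig (constructive_indefinite_description _ (Hsurj w))).
  assert (Hpsi : forall w, unit_disc (psi w) /\ phi (psi w) = w).
  { intros w. unfold psi. exact (proj2_sig (constructive_indefinite_description _ (Hsurj w))). }
  clearbody psi.
  destruct (univalent_order phi Ha Hu) as [k [B [Hk [RB [B0 HB]]]]].
  set (M := Cmod (B (RtoC 0)) + 1). pose proof (Cmod_ge_0 (B (RtoC 0))) as HM0.
  destruct (disc_argmax (fun w => Cmod (psi w)) (phi (RtoC 0)) M) as [p [Hp Hmax]].
  { unfold M; lra. }
  { intros p _ eps He. apply near_impl with (2 := analytic_inverse_continuous phi psi Ha Hu Hpsi p eps He).
    intros z Hz. apply Rabs_def1.
    - pose proof (Cmod_triangle_inv (psi z) (psi p)). lra.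
    - pose proof (Cmod_triangle_inv (psi p) (psi z)) as T. rewrite (Cmod_sub_sym (psi p)) in T. lra. }
  destruct (Hpsi p) as [Hpp _]. unfold unit_disc in Hpp.
  pose proof (Cmod_ge_0 (psi p)).
  set (rho := (1 + Cmod (psi p)) / 2).
  assert (Hbig : forall z, Cmod z = rho -> M <= Cmod (phi z - phi (RtoC 0))).
  { intros z Hz. apply Rnot_lt_le. intros Hlt.
    assert (E : psi (phi z) = z).
    { apply Hu. apply Hpsi. unfold unit_disc, rho in *; lra. apply Hpsi. }
    specialize (Hmax (phi z) ltac:(lra)). cbn beta in Hmax. rewrite E in Hmax. unfold rho in *; lra. }
  assert (Hne : forall z, unit_disc z -> z <> RtoC 0 -> (phi z - phi (RtoC 0))%C <> RtoC 0).
  { intros z Hz Hz0. apply Csub_neq. intros E. apply Hz0. apply Hu; auto. }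
  set (Q := fun z => if excluded_middle_informative (z = RtoC 0) then (/ B (RtoC 0))%C
                     else (z ^ k / (phi z - phi (RtoC 0)))%C).
  assert (HQ : Cmod (Q (RtoC 0)) <= / M).
  { apply (maximum_modulus Q 0 rho).
    - unfold rho; lra.
    - apply Rlt_le, Rinv_0_lt_compat. unfold M; lra.
    - intros z Hz. replace (z - 0)%C with z in Hz by ring.
      destruct (excluded_middle_informative (z = RtoC 0)) as [->|Hz0].
      + apply reg_ext with (fun z => / B z)%C. 2: now apply reg_inv.
        assert (RB1 : reg 1 B (RtoC 0)) by (apply reg_le with 3%nat; auto).
        apply near_impl with (2 := near_and _ _ _ HB (reg_neq0 _ _ RB1 B0)).
        intros v [E1 E2]. unfold Q. destruct (excluded_middle_informative (v = RtoC 0)) as [->|Hv0]; auto.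
        assert (B v <> RtoC 0). { apply Cmod_gt_0. apply Cmod_gt_0 in B0. lra. }
        pose proof (Cpow_nz v k Hv0).
        rewrite E1. replace (phi (RtoC 0) + v ^ k * B v - phi (RtoC 0))%C with (v ^ k * B v)%C by ring.
        field. auto.
      + assert (Hzd : unit_disc z) by (unfold unit_disc, rho in *; lra).
        apply reg_ext with (fun z => z ^ k / (phi z - phi (RtoC 0)))%C.
        * apply near_impl with (2 := near_neq z 0 Hz0). intros v Hv. unfold Q.
          destruct (excluded_middle_informative (v = RtoC 0)); tauto.
        * apply reg_div. apply reg_pow. apply reg_minus. eapply reg_analytic_on; eauto.
          apply reg_const. auto.
    - intros z Hz. replace (z - 0)%C with z in Hz by ring.
      assert (Hz0 : z <> RtoC 0) by (intros ->; rewrite Cmod_0 in Hz; unfold rho in *; lra).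
      assert (Hzd : unit_disc z) by (unfold unit_disc, rho in *; lra).
      unfold Q. destruct (excluded_middle_informative (z = RtoC 0)); [tauto|].
      rewrite Cmod_div by auto. specialize (Hbig z Hz).
      rewrite <- (Rmult_1_l (/ M)). apply Rmult_le_compat.
      + apply Cmod_ge_0.
      + apply Rlt_le, Rinv_0_lt_compat. apply Cmod_gt_0; auto.
      + rewrite Cmod_pow. rewrite <- (pow1 k). apply pow_incr. unfold unit_disc in Hzd.
        split; [apply Cmod_ge_0|lra].
      + apply Rinv_le_contravar; auto. unfold M; lra. }
  unfold Q in HQ. destruct (excluded_middle_informative (RtoC 0 = RtoC 0)); [|tauto].
  rewrite Cmod_inv in HQ by auto. apply Cmod_gt_0 in B0.
  assert (/ M < / Cmod (B (RtoC 0))).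
  { apply Rinv_lt_contravar. apply Rmult_lt_0_compat; unfold M; lra. unfold M; lra. }
  lra.
Qed.

(** * Convex images: separation and the bound on the coefficients of h *)

(** The separating line is found from slopes. In coordinates X + iY centred at q with
    p on the positive X axis, the part of S on the X axis lies at X > 0, since q is
    not in S. A segment of S crossing that axis crosses it at X > 0, which says that
    X/Y at a point with Y < 0 never exceeds X/Y at a point with Y > 0. Any c between
    the two families of slopes gives the functional X - cY, nonnegative on S. *)
Lemma convex_separation (S : C -> Prop) (p q : C) : convex_set S -> S p -> ~ S q ->
  exists u : C, u <> RtoC 0 /\ forall w, S w -> fst (u * (w - q))%C <= 0.
Proof.
  intros HS Hp Hq.
  assert (Hpq : (p - q)%C <> RtoC 0) by (apply Csub_neq; intros ->; auto).
  (* Multiplication by e turns p - q into the positive real number |p - q|^2. *)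
  set (e := Cconj (p - q)).
  assert (He : e <> RtoC 0) by (apply Cmod_gt_0; unfold e; rewrite Cmod_conj; now apply Cmod_gt_0).
  set (X := fun w : C => fst (e * (w - q))%C). set (Y := fun w : C => snd (e * (w - q))%C).
  assert (XYp : 0 < X p /\ Y p = 0).
  { assert (E : (e * (p - q) = RtoC (Cmod (p - q) ^ 2))%C) by (rewrite Cmod2_conj; unfold e; ring).
    unfold X, Y. rewrite E. simpl. split; auto. apply Cmod_gt_0 in Hpq.
    rewrite Rmult_1_r. apply Rmult_lt_0_compat; auto. }
  destruct XYp as [Xp Yp].
  assert (Haff : forall w1 w2 t, X (RtoC (1 - t) * w1 + RtoC t * w2)%C = (1 - t) * X w1 + t * X w2 /\
     Y (RtoC (1 - t) * w1 + RtoC t * w2)%C = (1 - t) * Y w1 + t * Y w2).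
  { intros. unfold X, Y. simpl. split; ring. }
  assert (Hnq : forall w, S w -> X w = 0 -> Y w = 0 -> False).
  { intros w Hw HX HY. apply Hq.
    assert (E : (e * (w - q))%C = RtoC 0) by (apply injective_projections; auto).
    replace q with w; auto. replace w with (q + / e * (e * (w - q)))%C by (field; auto).
    rewrite E. ring. }
  assert (Hax : forall w, S w -> Y w = 0 -> 0 < X w).
  { intros w Hw HY. apply Rnot_le_lt. intros HX.
    set (t := X p / (X p - X w)).
    assert (Ht : 0 <= t <= 1).
    { unfold t. split. apply Rmult_le_pos; [lra|]. apply Rlt_le, Rinv_0_lt_compat; lra.
      apply Rmult_le_reg_r with (X p - X w); [lra|]. unfold Rdiv. rewrite Rmult_assoc, Rinv_l; lra. }
    destruct (Haff p w t) as [EX EY].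
    apply (Hnq (RtoC (1 - t) * p + RtoC t * w)%C). apply HS; auto.
    rewrite EX. unfold t. field. lra. rewrite EY, HY, Yp. ring. }
  assert (Hcross : forall w1 w2, S w1 -> S w2 -> Y w2 < 0 < Y w1 -> X w2 / Y w2 <= X w1 / Y w1).
  { intros w1 w2 H1 H2 [HY2 HY1].
    set (t := Y w1 / (Y w1 - Y w2)).
    assert (Ht : 0 <= t <= 1).
    { unfold t. split. apply Rmult_le_pos; [lra|]. apply Rlt_le, Rinv_0_lt_compat; lra.
      apply Rmult_le_reg_r with (Y w1 - Y w2); [lra|]. unfold Rdiv. rewrite Rmult_assoc, Rinv_l; lra. }
    destruct (Haff w1 w2 t) as [EX EY].
    assert (G : 0 < (1 - t) * X w1 + t * X w2).
    { rewrite <- EX. apply Hax. apply HS; auto. rewrite EY. unfold t. field. lra. }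
    assert (E : (1 - t) * X w1 + t * X w2
       = (X w1 / Y w1 - X w2 / Y w2) * (Y w1 * - Y w2 / (Y w1 - Y w2))) by (unfold t; field; lra).
    rewrite E in G.
    assert (0 < Y w1 * - Y w2 / (Y w1 - Y w2)).
    { apply Rdiv_lt_0_compat. apply Rmult_lt_0_compat; lra. lra. }
    apply Rnot_lt_le. intros Hlt.
    apply Rlt_not_le in G. apply G.
    rewrite <- (Rmult_0_l (Y w1 * - Y w2 / (Y w1 - Y w2))). apply Rmult_le_compat_r; lra. }
  destruct (classic (exists w, S w /\ Y w < 0)) as [[wd [Hd HYd]]|Hno].
  2: { exists (Ci * e)%C. split.
    - apply Cmod_gt_0. rewrite Cmod_mult, Cmod_Ci, Rmult_1_l. now apply Cmod_gt_0.
    - intros w Hw. replace (fst (Ci * e * (w - q))%C) with (- Y w) by (unfold Y; simpl; ring).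
      assert (~ Y w < 0) by (intros H; apply Hno; eauto). lra. }
  destruct (classic (exists w, S w /\ 0 < Y w)) as [[wu [Hw HYu]]|Hno].
  2: { exists (- (Ci * e))%C. split.
    - apply Cmod_gt_0. rewrite Cmod_opp, Cmod_mult, Cmod_Ci, Rmult_1_l. now apply Cmod_gt_0.
    - intros w Hw. replace (fst (- (Ci * e) * (w - q))%C) with (Y w) by (unfold Y; simpl; ring).
      assert (~ 0 < Y w) by (intros H; apply Hno; eauto). lra. }
  destruct (completeness (fun x => exists w, S w /\ Y w < 0 /\ x = X w / Y w)) as [c [HU HL]].
  { exists (X wu / Y wu). intros x [w [HSw [HY ->]]]. apply Hcross; auto. }
  { exists (X wd / Y wd). eauto. }
  exists (e * ((-1, - c)%R : C))%C. split.
  - apply Cmod_gt_0. rewrite Cmod_mult. apply Rmult_lt_0_compat. now apply Cmod_gt_0.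
    apply Cmod_gt_0. intros E. apply (f_equal fst) in E. simpl in E. lra.
  - intros w HSw. replace (fst (e * ((-1, - c)%R : C) * (w - q))%C) with (- X w + c * Y w)
      by (unfold X, Y; simpl; ring).
    destruct (Rtotal_order (Y w) 0) as [HY|[HY|HY]].
    + assert (X w / Y w <= c) by (apply HU; eauto).
      assert (E : X w = X w / Y w * Y w) by (field; lra). nra.
    + specialize (Hax w HSw HY). rewrite HY. lra.
    + assert (c <= X w / Y w).
      { apply HL. intros x [v [HSv [HYv ->]]]. apply Hcross; auto. }
      assert (E : X w = X w / Y w * Y w) by (field; lra). nra.
Qed.

Lemma series_at_delta (b z : C) :
  series_at (fun n => match n with O => b | S _ => RtoC 0 end) z b.
Proof.
  unfold series_at. rewrite Clim_incr. apply Clim_ext with (fun _ => b). 2: apply Clim_const.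
  intros n. unfold psum. rewrite csum_first, (csum_ext _ (fun _ => RtoC 0)).
  rewrite csum_const. simpl; ring. intros; ring.
Qed.

(** After rotation by u, the separating line confines h - h(0) to a half-plane at
    distance at most |q - h(0)| from 0. *)
Lemma convex_coefficient_le (S : C -> Prop) (q : C) a h n : convex_set S -> ~ S q ->
  sums_on 1 a h -> (forall z, Cmod z < 1 -> S (h z)) -> (1 <= n)%nat ->
  Cmod (a n) <= 2 * Cmod (q - h (RtoC 0)).
Proof.
  intros HS Hq Hh HSh Hn.
  assert (S0 : S (h (RtoC 0))) by (apply HSh; rewrite Cmod_0; lra).
  destruct (convex_separation S (h (RtoC 0)) q HS S0 Hq) as [u [Hu Hsep]].
  assert (Hd : 0 < Cmod (q - h (RtoC 0))).
  { apply Cmod_gt_0, Csub_neq. intros ->. auto. }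
  set (d := Cmod (q - h (RtoC 0))) in *.
  apply Cmod_gt_0 in Hu.
  set (f := fun z => (u * h z + - (u * a O))%C).
  set (c := fun n => (u * a n + match n with O => - (u * a O) | Datatypes.S _ => RtoC 0 end)%C).
  assert (Hf : sums_on 1 c f).
  { intros z Hz. apply series_at_plus. apply series_at_scal; auto. apply series_at_delta. }
  destruct (power_series_tower c f Hf) as [F [F0 HF]].
  assert (Ha0 : h (RtoC 0) = a O).
  { apply Clim_unique with (psum a 0). apply Hh. rewrite Cmod_0; lra. apply series_at_0. }
  assert (HB : Cmod (c n) <= 2 * (Cmod u * d)).
  { apply half_plane_coefficient_le with F; auto.
    - unfold c. ring.
    - apply Rmult_lt_0_compat; auto.
    - intros z Hz. rewrite F0.
      replace (f z) with (u * (h z - q) + u * (q - h (RtoC 0)))%C by (unfold f; rewrite Ha0; ring).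
      pose proof (Hsep (h z) (HSh z Hz)) as H1.
      pose proof (re_le_Cmod (u * (q - h (RtoC 0)))%C) as H2. apply Rabs_le_between in H2.
      rewrite Cmod_mult in H2. fold d in H2. unfold Re in H2.
      change (fst (u * (h z - q))%C + fst (u * (q - h (RtoC 0)))%C <= Cmod u * d). lra. }
  assert (E : c n = (u * a n)%C) by (unfold c; destruct n; [lia|ring]).
  rewrite E, Cmod_mult in HB. apply Rmult_le_reg_l with (Cmod u); auto. lra.
Qed.

(** The supremum of the parameters at which the segment from p to q is in S gives a
    boundary point. *)
Lemma segment_boundary (S : C -> Prop) (p q : C) : S p -> ~ S q -> exists b, boundary S b.
Proof.
  intros Hp Hq.
  set (g := fun t : R => (p + RtoC t * (q - p))%C).
  assert (Hg : forall s t, Cmod (g s - g t) = Rabs (s - t) * Cmod (q - p)).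
  { intros s t. rewrite <- Cmod_R, <- Cmod_mult. f_equal. unfold g. rewrite RtoC_minus. ring. }
  assert (g0 : g 0 = p) by (unfold g; ring). assert (g1 : g 1 = q) by (unfold g; ring).
  destruct (completeness (fun t => 0 <= t <= 1 /\ S (g t))) as [t [HU HL]].
  { exists 1. intros t [Ht _]. lra. }
  { exists 0. rewrite g0. split; auto. lra. }
  assert (Ht : 0 <= t <= 1).
  { split. apply HU. rewrite g0. split; auto; lra. apply HL. intros x [Hx _]. lra. }
  exists (g t). intros [eps He]. simpl. pose proof (Cmod_ge_0 (q - p)) as Hqp.
  set (d := eps / (Cmod (q - p) + 1)).
  assert (Hd : 0 < d) by (apply Rdiv_lt_0_compat; lra).
  assert (Hdd : d * Cmod (q - p) < eps).
  { apply Rlt_le_trans with (d * (Cmod (q - p) + 1)). apply Rmult_lt_compat_l; lra.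
    right; unfold d; field; lra. }
  split.
  - assert (H : exists s, (0 <= s <= 1 /\ S (g s)) /\ t - d < s).
    { apply NNPP. intros HN. assert (t <= t - d); [|lra]. apply HL. intros s Hs.
      apply Rnot_lt_le. intros Hlt. apply HN. eauto. }
    destruct H as [s [Hs Hts]]. exists (g s). split; [|tauto]. rewrite Hg.
    apply Rle_lt_trans with (2 := Hdd). apply Rmult_le_compat_r; auto.
    specialize (HU s Hs). apply Rabs_le; lra.
  - destruct (Rle_lt_dec 1 (t + d)) as [H|H].
    + exists q. split; auto. rewrite <- g1, Hg.
      apply Rle_lt_trans with (2 := Hdd). apply Rmult_le_compat_r; auto. apply Rabs_le; lra.
    + exists (g (t + d)). split.
      * rewrite Hg. apply Rle_lt_trans with (2 := Hdd). apply Rmult_le_compat_r; auto.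
        apply Rabs_le; lra.
      * intros HSd. assert (t + d <= t); [|lra]. apply HU. split; auto. lra.
Qed.

(** For a nonempty set the infimum is finite. *)
Lemma dist_to_set_approx (p : C) (B : C -> Prop) : (exists b, B b) ->
  0 <= dist_to_set p B /\
  (forall b, B b -> dist_to_set p B <= Cmod (b - p)) /\
  forall eps, 0 < eps -> exists b, B b /\ Cmod (b - p) < dist_to_set p B + eps.
Proof.
  intros [b0 Hb0]. unfold dist_to_set.
  set (E := fun x : R => exists q : C, B q /\ x = Cmod (q - p)).
  destruct (Glb_Rbar_correct E) as [HL HG].
  pose proof (HL (Cmod (b0 - p)) ltac:(exists b0; auto)) as H0.
  assert (H1 : Rbar_le 0 (Glb_Rbar E)).
  { apply HG. intros x [b [_ ->]]. apply Cmod_ge_0. }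
  destruct (Glb_Rbar E) as [g| |]; simpl in *; try tauto.
  split; auto. split.
  - intros b Hb. apply (HL (Cmod (b - p))). exists b; auto.
  - intros eps He. apply NNPP. intros HN.
    assert (H : g + eps <= g); [|lra]. apply (HG (g + eps)). intros x [b [Hb ->]]. simpl.
    apply Rnot_lt_le. intros Hlt. apply HN. eauto.
Qed.

(** Near a boundary point almost realizing the distance there is a point outside the
    image, to which [convex_coefficient_le] applies. Subordination puts h(D) inside
    phi(D) and gives h(0) = phi(0). *)
Lemma subordinate_coefficient_le (phi h : C -> C) a : convex_univalent phi -> subordinate h phi ->
  sums_on 1 a h -> 
  0 <= dist_to_set (phi (RtoC 0)) (boundary (image phi unit_disc)) /\
  h (RtoC 0) = phi (RtoC 0) /\
  forall n, (1 <= n)%nat ->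
    Cmod (a n) <= 2 * dist_to_set (phi (RtoC 0)) (boundary (image phi unit_disc)).
Proof.
  intros [Ha [Hu Hc]] [w [_ [Hw [Hw0 Hh]]]] Hs.
  assert (D0 : unit_disc (RtoC 0)) by (unfold unit_disc; rewrite Cmod_0; lra).
  destruct (univalent_not_onto phi Ha Hu) as [q Hq].
  assert (Hb : exists b, boundary (image phi unit_disc) b).
  { apply segment_boundary with (phi (RtoC 0)) q; auto. exists (RtoC 0). auto. }
  destruct (dist_to_set_approx (phi (RtoC 0)) _ Hb) as [Hd [_ Happ]].
  set (d := dist_to_set _ _) in *. split; auto.
  assert (H0 : h (RtoC 0) = phi (RtoC 0)) by (rewrite Hh, Hw0; auto).
  split; auto. intros n Hn. apply le_epsilon. intros eps He.
  destruct (Happ (eps / 4)) as [b [Hbb Hbd]]; [lra|].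
  assert (He4 : 0 < eps / 4) by lra.
  destruct (Hbb (mkposreal _ He4)) as [_ [p [Hp1 Hp2]]]. simpl in Hp1.
  assert (HB : Cmod (a n) <= 2 * Cmod (p - h (RtoC 0))).
  { apply convex_coefficient_le with (image phi unit_disc); auto.
    intros z Hz. exists (w z). split; auto. symmetry. auto. }
  rewrite H0 in HB. pose proof (Cmod_triangle (p - b) (b - phi (RtoC 0))) as T.
  replace (p - b + (b - phi (RtoC 0)))%C with (p - phi (RtoC 0))%C in T by ring. lra.
Qed.

(** * The dilatation, the coefficients of g and the Bohr inequality *)

(** Bohr's theorem. Dividing by M > k and writing x for the modulus of the constant
    coefficient, the normalized sum is at most x + (1 - x^2) (1/3 + 1/9 + ...) = x +
    (1 - x^2)/2, which is at most 1; then M tends to k. Strictness of M > k covers the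
    case k = 0 as well. *)
Lemma bounded_tower_bohr F c k : tower F c -> 0 <= k ->
  (forall z, Cmod z < 1 -> Cmod (F O z) <= k) ->
  forall r, 0 <= r <= 1 / 3 ->
  exists s, is_series (fun n => Cmod (c n) * r ^ n) s /\ s <= k.
Proof.
  intros H Hk HF r Hr.
  assert (HM : forall M, k < M -> forall n, (1 <= n)%nat ->
     Cmod (c n) / M <= 1 - (Cmod (c O) / M) ^ 2).
  { intros M HkM n Hn.
    assert (E : forall x, Cmod (RtoC (/ M) * x) = Cmod x / M).
    { intros x. rewrite Cmod_mult, Cmod_R, Rabs_pos_eq. unfold Rdiv; ring.
      apply Rlt_le, Rinv_0_lt_compat; lra. }
    rewrite <- !E. apply (bounded_coefficient_le _ _ n (tower_scal (RtoC (/ M)) F c H)); auto.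
    intros z Hz. rewrite E. specialize (HF z Hz).
    apply Rmult_lt_reg_r with M. lra. unfold Rdiv. rewrite Rmult_assoc, Rinv_l; lra. }
  assert (Hc0 : Cmod (c O) <= k).
  { rewrite <- (tower_0 F c O H). apply HF. rewrite Cmod_0; lra. }
  pose proof (Cmod_ge_0 (c O)) as Hc0'.
  assert (Hsum : forall M n, k < M -> sum_n (fun n => Cmod (c n) * r ^ n) n <= M).
  { intros M n HkM. set (x := Cmod (c O) / M).
    assert (Hx : 0 <= x < 1).
    { unfold x. split. apply Rmult_le_pos; auto. apply Rlt_le, Rinv_0_lt_compat; lra.
      apply Rmult_lt_reg_r with M. lra. unfold Rdiv. rewrite Rmult_assoc, Rinv_l; lra. }
    assert (Hx2 : 0 <= 1 - x ^ 2) by (simpl; nra).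
    (* (1 - (1/3)^n)/2 is the sum of (1/3)^j over j from 1 to n. *)
    assert (G : sum_n (fun n => Cmod (c n) * r ^ n) n <= M * (x + (1 - x ^ 2) * ((1 - (1 / 3) ^ n) / 2))).
    { induction n.
      - rewrite sum_O. simpl. unfold x. right. field. lra.
      - rewrite sum_Sn. unfold plus; simpl.
        assert (B : Cmod (c (S n)) <= M * (1 - x ^ 2)).
        { specialize (HM M HkM (S n) ltac:(lia)). fold x in HM.
          apply Rmult_le_compat_l with (r := M) in HM; [|lra].
          replace (M * (Cmod (c (S n)) / M)) with (Cmod (c (S n))) in HM by (field; lra). auto. }
        assert (P : r ^ S n <= (1 / 3) ^ S n) by (apply pow_incr; lra).
        assert (P0 : 0 <= r ^ S n) by (apply pow_le; lra).
        pose proof (Rmult_le_compat _ _ _ _ (Cmod_ge_0 _) P0 B P) as Q. simpl in Q, IHn |- *. lra. }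
    apply Rle_trans with (1 := G). rewrite <- (Rmult_1_r M) at 2. apply Rmult_le_compat_l. lra.
    assert (0 < (1 / 3) ^ n) by (apply pow_lt; lra).
    assert ((1 - x ^ 2) * ((1 - (1 / 3) ^ n) / 2) <= (1 - x ^ 2) * (1 / 2)) by (apply Rmult_le_compat_l; lra).
    assert (0 <= (1 - x) * (1 - x)) by (apply Rmult_le_pos; lra). simpl in *. lra. }
  destruct (ex_series_le (K := R_AbsRing) (V := R_CompleteNormedModule)
    (fun n => Cmod (c n) * r ^ n) (fun n => (k + 1) * (1 / 3) ^ n)) as [s Hs].
  - intros n. unfold norm; simpl. unfold abs; simpl.
    rewrite Rabs_pos_eq by (apply Rmult_le_pos; [apply Cmod_ge_0|apply pow_le; lra]).
    apply Rmult_le_compat. apply Cmod_ge_0. apply pow_le; lra.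
    + destruct n. lra. specialize (HM (k + 1) ltac:(lra) (S n) ltac:(lia)).
      pose proof (pow2_ge_0 (Cmod (c O) / (k + 1))).
      apply Rmult_le_reg_r with (/ (k + 1)). apply Rinv_0_lt_compat; lra.
      rewrite Rinv_r by lra. unfold Rdiv in *. lra.
    + apply pow_incr; lra.
  - eexists. apply is_series_scaled_geom. rewrite Rabs_pos_eq; lra.
  - exists s. split; auto. apply le_epsilon. intros eps He.
    apply (is_lim_seq_le (sum_n (fun n => Cmod (c n) * r ^ n)) (fun _ => k + eps) s (k + eps)).
    + intros n. apply Hsum. lra.
    + exact Hs.
    + apply is_lim_seq_const.
Qed.

Lemma sums_on_unique R0 c f g z : sums_on R0 c f -> sums_on R0 c g -> Cmod z < R0 -> f z = g z.
Proof. intros Hf Hg Hz. exact (Clim_unique _ _ _ (Hf z Hz) (Hg z Hz)). Qed.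

(** Long division of the series beta by alpha: the coefficients left after j steps,
    shifted by j. *)
Fixpoint quotient_remainder (beta alpha : nat -> C) (j : nat) : nat -> C :=
  match j with
  | O => beta
  | S i => fun n => (quotient_remainder beta alpha i (S n)
      - quotient_remainder beta alpha i O / alpha O * alpha (S n))%C
  end.

Definition quotient_coef (beta alpha : nat -> C) (j : nat) : C :=
  (quotient_remainder beta alpha j O / alpha O)%C.

Lemma quotient_remainder_conv beta alpha j n :
  quotient_remainder beta alpha j n =
  (beta (n + j)%nat - csum (fun l => quotient_coef beta alpha l * alpha (n + j - l)%nat) j)%C.
Proof.
  revert n. induction j; intros n; simpl.
  - rewrite Nat.add_0_r. ring.
  - rewrite (IHj (S n)). fold (quotient_coef beta alpha j).
    replace (S n + j)%nat with (n + S j)%nat by lia.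
    replace (n + S j - j)%nat with (S n) by lia. ring.
Qed.

Lemma quotient_coef_conv beta alpha n : alpha O <> RtoC 0 ->
  beta n = csum (fun l => quotient_coef beta alpha l * alpha (n - l)%nat)%C (S n).
Proof.
  intros H0. pose proof (quotient_remainder_conv beta alpha n 0) as E. simpl in E.
  cbn [csum]. rewrite Nat.sub_diag. unfold quotient_coef at 2. rewrite E. field. auto.
Qed.

Lemma quotient_step e E alpha H : alpha O <> RtoC 0 -> sums_on 1 e E -> sums_on 1 alpha H ->
  exists E', sums_on 1 (fun n => e (S n) - e O / alpha O * alpha (S n))%C E' /\
    forall z, Cmod z < 1 -> E z = (e O / alpha O * H z + z * E' z)%C.
Proof.
  intros H0 HE HH. set (q := (e O / alpha O)%C).
  assert (HG : sums_on 1 (fun n => e n + - q * alpha n)%C (fun z => E z + - q * H z)%C).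
  { intros z Hz. apply series_at_plus; auto. apply series_at_scal; auto. }
  destruct (sums_on_tower _ _ _ Rlt_0_1 HG) as [F [F0 [HF HS]]].
  exists (F 1%nat). split.
  - intros z Hz. eapply Clim_ext. 2: exact (HF 1%nat z Hz). intros n. apply csum_ext.
    intros k _. simpl. ring.
  - intros z Hz. specialize (HS O z Hz). rewrite F0 in HS. cbn beta in HS.
    replace (E z) with (E z + - q * H z + q * H z)%C by ring. rewrite HS.
    unfold q. field. auto.
Qed.

(** The j-th shift of G/H is E_j/H, where E_j is the sum of the j-th division
    remainder. Each E_j is a power series on the whole disc, so the zero-free
    denominator H causes no loss of radius. *)
Lemma quotient_tower beta alpha G H : sums_on 1 beta G -> sums_on 1 alpha H ->
  (forall z, Cmod z < 1 -> H z <> RtoC 0) ->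
  exists F, (forall z, Cmod z < 1 -> F O z = (G z / H z)%C) /\ tower F (quotient_coef beta alpha).
Proof.
  intros HG HH HH0.
  assert (H0 : alpha O <> RtoC 0).
  { assert (D0 : Cmod 0 < 1) by (rewrite Cmod_0; lra).
    rewrite <- (Clim_unique _ _ _ (HH 0 D0) (series_at_0 alpha)). auto. }
  assert (Hex : forall j, exists E, sums_on 1 (quotient_remainder beta alpha j) E).
  { induction j as [|j [E HE]]. exists G; auto.
    destruct (quotient_step _ _ _ _ H0 HE HH) as [E' [HE' _]]. exists E'. exact HE'. }
  set (E := fun j => proj1_sig (constructive_indefinite_description _ (Hex j))).
  assert (HE : forall j, sums_on 1 (quotient_remainder beta alpha j) (E j)).
  { intros j. exact (proj2_sig (constructive_indefinite_description _ (Hex j))). }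
  clearbody E. exists (fun j z => (E j z / H z)%C). split.
  - intros z Hz. f_equal. exact (sums_on_unique _ _ _ _ z (HE O) HG Hz).
  - intros j z Hz. split.
    + apply reg_div; auto; eapply reg_sums_on; eauto.
    + destruct (quotient_step _ _ _ _ H0 (HE j) HH) as [E' [HE' HS]].
      rewrite (HS z Hz). rewrite (sums_on_unique _ _ _ _ z (HE (S j)) HE' Hz).
      unfold quotient_coef. field. auto.
Qed.

(** From (n+1) b_(n+1) = sum over l of c_l (n-l+1) a_(n-l+1) and (n-l+1)/(n+1) <= 1,
    the series of |b_n| r^n is dominated by the Cauchy product of the series of |c_l|
    r^l and D r^(j+1). *)
Lemma dilatation_bound_coefficients k h g a b D r : 0 <= k ->
  sums_on 1 a h -> sums_on 1 b g ->
  (forall z, Cmod z < 1 -> C_derive h z <> RtoC 0 /\ Cmod (dilatation h g z) <= k) ->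
  (forall n, (1 <= n)%nat -> Cmod (a n) <= D) -> 0 <= r <= 1 / 3 ->
  Series (fun n => Cmod (b (n + 1)%nat) * r ^ (n + 1)) <= k * (D * r / (1 - r)).
Proof.
  intros Hk Ha Hb Hdil HD Hr.
  set (alpha := fun i => (RtoC (INR (S i)) * a (S i))%C).
  set (beta := fun i => (RtoC (INR (S i)) * b (S i))%C).
  assert (HD0 : 0 <= D) by (apply Rle_trans with (2 := HD 1%nat (Nat.le_refl 1)); apply Cmod_ge_0).
  assert (HA : sums_on 1 alpha (C_derive h)) by (intros z Hz; now apply (C_derive_sums_on 1)).
  assert (HB : sums_on 1 beta (C_derive g)) by (intros z Hz; now apply (C_derive_sums_on 1)).
  destruct (quotient_tower beta alpha _ _ HB HA) as [F [F0 HF]].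
  { intros z Hz. apply Hdil; auto. }
  set (c := quotient_coef beta alpha) in *.
  destruct (bounded_tower_bohr F c k HF Hk) with (r := r) as [s [Hs Hsk]]; auto.
  { intros z Hz. rewrite F0 by auto. now apply Hdil. }
  assert (Ha0 : alpha O <> RtoC 0).
  { rewrite <- (Clim_unique _ _ _ (HA 0 ltac:(rewrite Cmod_0; lra)) (series_at_0 alpha)).
    apply Hdil. rewrite Cmod_0; lra. }
  assert (HG : is_series (fun n => (D * r) * r ^ n) (D * r / (1 - r))).
  { apply is_series_scaled_geom. rewrite Rabs_pos_eq; lra. }
  assert (HP := is_series_mult_pos _ _ _ _ Hs HG).
  assert (Hpos : 0 <= D * r / (1 - r)).
  { apply Rmult_le_pos. apply Rmult_le_pos; lra. apply Rlt_le, Rinv_0_lt_compat; lra. }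
  apply Rle_trans with (s * (D * r / (1 - r))). 2: now apply Rmult_le_compat_r.
  assert (HP' : is_series (fun n => sum_f_R0 (fun k => Cmod (c k) * r ^ k * (D * r * r ^ (n - k))) n)
    (s * (D * r / (1 - r)))).
  { apply HP.
    - intros n. apply Rmult_le_pos; [apply Cmod_ge_0|apply pow_le; lra].
    - intros n. repeat apply Rmult_le_pos; try lra. apply pow_le; lra. }
  rewrite <- (is_series_unique _ _ HP'). apply Series_le; [|eexists; exact HP'].
  intros n. split. apply Rmult_le_pos; [apply Cmod_ge_0|apply pow_le; lra].
  assert (Hn : 0 < INR (S n)) by (apply lt_0_INR; lia).
  assert (B1 : INR (S n) * Cmod (b (S n)) <=
     sum_n (fun l => Cmod (c l) * (INR (S n) * D)) n).
  { replace (INR (S n) * Cmod (b (S n))) with (Cmod (beta n))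
      by (unfold beta; rewrite Cmod_mult, Cmod_R, Rabs_pos_eq; lra).
    rewrite (quotient_coef_conv beta alpha n Ha0). eapply Rle_trans. apply csum_Cmod_le.
    apply sum_n_m_le. intros l. rewrite Cmod_mult. apply Rmult_le_compat_l. apply Cmod_ge_0.
    unfold alpha. rewrite Cmod_mult, Cmod_R, Rabs_pos_eq by apply pos_INR.
    apply Rmult_le_compat; auto using pos_INR, Cmod_ge_0.
    - apply le_INR. lia.
    - apply HD. lia. }
  replace (n + 1)%nat with (S n) by lia.
  rewrite sum_n_Reals in B1.
  replace (sum_f_R0 (fun l => Cmod (c l) * (INR (S n) * D)) n)
    with (INR (S n) * sum_f_R0 (fun l => Cmod (c l) * D) n) in B1.
  2: { rewrite scal_sum. apply sum_eq. intros; ring. }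
  apply Rmult_le_reg_l in B1; auto.
  apply Rle_trans with (sum_f_R0 (fun l => Cmod (c l) * D) n * r ^ S n).
  - apply Rmult_le_compat_r; auto. apply pow_le; lra.
  - right. rewrite Rmult_comm, scal_sum. apply sum_eq. intros l Hl.
    replace (S n) with (l + S (n - l))%nat at 1 by lia. rewrite pow_add. simpl. ring.
Qed.

(** Apart from |phi(0)|, each term is at most 2d times the matching term of F + 1/2,
    the two series together matching the term in lambda. *)
Lemma bohr_sum_bound K m lambda f h g a b phi z : 1 <= K -> 0 < lambda -> (1 <= m)%nat ->
  sense_preserving_qc K f h g -> power_expansions h g a b ->
  convex_univalent phi -> subordinate h phi -> Cmod z <= 1 / 3 ->
  let d := dist_to_set (phi (RtoC 0)) (boundary (image phi unit_disc)) in
  0 <= d /\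
  bohr_sum m lambda h a b z
  <= Cmod (phi (RtoC 0)) + 2 * d * (F K m lambda (Cmod z) + 1 / 2).
Proof.
  intros HK Hl Hm [_ [_ [_ Hqc]]] [_ Hpow] Hphi Hsub Hz.
  assert (Ha : sums_on 1 a h) by (intros w Hw; apply is_pseries_series_at; now apply Hpow).
  assert (Hb : sums_on 1 b g) by (intros w Hw; apply is_pseries_series_at; now apply Hpow).
  destruct (subordinate_coefficient_le phi h a Hphi Hsub Ha) as [Hd [H0 Hcoef]].
  set (d := dist_to_set _ _) in *. intros d'. subst d'. split; auto.
  set (r := Cmod z) in *. assert (Hr : 0 <= r) by apply Cmod_ge_0.
  unfold bohr_sum. fold r.
  set (rho := r ^ m).
  assert (Hrho : 0 <= rho < 1).
  { unfold rho. split. apply pow_le; auto. destruct m; [lia|].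
    apply pow_lt_1_compat; [lra|lia]. }
  assert (Hzm : Cmod (Cpow z m) = rho) by (unfold rho, r; apply Cmod_pow).
  assert (T1 : Cmod (h (Cpow z m)) <= Cmod (phi (RtoC 0)) + 2 * d * (rho / (1 - rho))).
  { destruct (sums_on_tower _ _ _ Rlt_0_1 Ha) as [T [T0 [HT HS]]].
    rewrite <- T0, (HS O) by lra. eapply Rle_trans. apply Cmod_triangle.
    apply Rplus_le_compat.
    - right. f_equal. rewrite <- H0. symmetry.
      apply (Clim_unique _ _ _ (Ha (RtoC 0) ltac:(rewrite Cmod_0; lra)) (series_at_0 a)).
    - rewrite Cmod_mult, Hzm.
      replace (2 * d * (rho / (1 - rho))) with (rho * (2 * d / (1 - rho))) by (field; lra).
      apply Rmult_le_compat_l; [lra|].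
      apply (series_at_le (fun n => a (1 + n)%nat) (Cpow z m) _ (fun n => 2 * d * rho ^ n)).
      + intros n. rewrite Hzm. apply Rmult_le_compat_r. apply pow_le; lra. apply Hcoef. lia.
      + apply is_series_scaled_geom. rewrite Rabs_pos_eq; lra.
      + apply (HT 1%nat). lra. }
  assert (T2 : Cmod (C_derive h (Cpow z m)) * r <= 2 * d * (r / (1 - rho) ^ 2)).
  { replace (2 * d * (r / (1 - rho) ^ 2)) with (2 * d * / (1 - rho) ^ 2 * r) by (field; lra).
    apply Rmult_le_compat_r; auto.
    apply (series_at_le (fun i => RtoC (INR (S i)) * a (S i))%C (Cpow z m) _
      (fun n => 2 * d * (INR (S n) * rho ^ n))).
    - intros n. rewrite Hzm, Cmod_mult, Cmod_R, Rabs_pos_eq by apply pos_INR.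
      apply Rle_trans with (INR (S n) * (2 * d) * rho ^ n); [|right; ring].
      apply Rmult_le_compat_r. apply pow_le; lra.
      apply Rmult_le_compat_l. apply pos_INR. apply Hcoef. lia.
    - apply (is_series_scal_l (K := R_AbsRing) (V := R_NormedModule) (2 * d)).
      now apply is_series_geom_deriv.
    - apply (C_derive_sums_on 1); auto. lra. }
  assert (T3 : Series (fun n => Cmod (a (n + 2)%nat) * r ^ (n + 2)) <= 2 * d * (r ^ 2 / (1 - r))).
  { assert (E : is_series (fun n => 2 * d * r ^ 2 * r ^ n) (2 * d * r ^ 2 / (1 - r))).
    { apply is_series_scaled_geom. rewrite Rabs_pos_eq; lra. }
    replace (2 * d * (r ^ 2 / (1 - r))) with (2 * d * r ^ 2 / (1 - r)) by (field; lra).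
    rewrite <- (is_series_unique _ _ E). apply Series_le; [|eexists; exact E].
    intros n. split. apply Rmult_le_pos; [apply Cmod_ge_0|apply pow_le; lra].
    rewrite pow_add. apply Rle_trans with (2 * d * (r ^ n * r ^ 2)); [|right; ring].
    apply Rmult_le_compat_r. apply Rmult_le_pos; apply pow_le; lra. apply Hcoef. lia. }
  assert (T4 : Series (fun n => Cmod (b (n + 1)%nat) * r ^ (n + 1))
     <= (K - 1) / (K + 1) * (2 * d * r / (1 - r))).
  { apply dilatation_bound_coefficients with h g a; auto.
    - apply Rmult_le_pos; [lra|]. apply Rlt_le, Rinv_0_lt_compat; lra.
    - intros w Hw. destruct (Hqc w Hw) as [A [_ B]]. auto. }
  pose proof (Rplus_le_compat _ _ _ _ T3 T4) as T34.
  apply Rmult_le_compat_l with (r := lambda) in T34; [|lra].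
  pose proof (Rplus_le_compat _ _ _ _ (Rplus_le_compat _ _ _ _ T1 T2) T34) as T.
  eapply Rle_trans. exact T. right. unfold F. fold rho. field. lra.
Qed.

(** * The radius *)

Lemma pow_in_unit r m : (1 <= m)%nat -> 0 <= r < 1 -> 0 <= r ^ m < 1.
Proof.
  intros Hm Hr. split. apply pow_le; lra. destruct m; [lia|]. apply pow_lt_1_compat; [lra|lia].
Qed.

Lemma F_increasing K m lambda r s : 1 <= K -> 0 < lambda -> (1 <= m)%nat -> 0 <= r < s -> s < 1 ->
  F K m lambda r < F K m lambda s.
Proof.
  intros HK Hl Hm Hrs Hs. unfold F.
  assert (P : r ^ m <= s ^ m) by (apply pow_incr; lra).
  destruct (pow_in_unit r m Hm) as [P1 P2]; [lra|].
  destruct (pow_in_unit s m Hm) as [P3 P4]; [lra|].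
  set (x := r ^ m) in *. set (y := s ^ m) in *.
  assert (I1 : / (1 - x) <= / (1 - y)) by (apply Rinv_le_contravar; lra).
  assert (I0 : 0 < / (1 - x)) by (apply Rinv_0_lt_compat; lra).
  assert (T1 : x / (1 - x) <= y / (1 - y)) by (apply Rmult_le_compat; lra).
  assert (T2 : r / (1 - x) ^ 2 < s / (1 - y) ^ 2).
  { unfold Rdiv. apply Rlt_le_trans with (s * / (1 - x) ^ 2).
    - apply Rmult_lt_compat_r; [|lra]. apply Rinv_0_lt_compat, pow_lt; lra.
    - apply Rmult_le_compat_l; [lra|]. apply Rinv_le_contravar. apply pow_lt; lra.
      apply pow_incr; lra. }
  assert (T3 : lambda * (K - 1 + r * (K + 1)) * r / ((K + 1) * (1 - r))
     <= lambda * (K - 1 + s * (K + 1)) * s / ((K + 1) * (1 - s))).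
  { assert (0 <= r * (K + 1)) by (apply Rmult_le_pos; lra).
    assert (r * (K + 1) <= s * (K + 1)) by (apply Rmult_le_compat_r; lra).
    unfold Rdiv. apply Rmult_le_compat.
    - repeat apply Rmult_le_pos; lra.
    - apply Rlt_le, Rinv_0_lt_compat, Rmult_lt_0_compat; lra.
    - apply Rmult_le_compat; try lra. apply Rmult_le_pos; lra.
      apply Rmult_le_compat_l; lra.
    - apply Rinv_le_contravar. apply Rmult_lt_0_compat; lra. apply Rmult_le_compat_l; lra. }
  lra.
Qed.

Lemma F_continuous K m lambda r : 1 <= K -> (1 <= m)%nat -> 0 <= r < 1 ->
  continuity_pt (F K m lambda) r.
Proof.
  intros HK Hm Hr. destruct (pow_in_unit r m Hm Hr) as [P1 P2].
  apply derivable_continuous_pt. apply ex_derive_Reals_0. unfold F. auto_derive.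
  repeat split; try lra. apply Rmult_integral_contrapositive; split; lra.
  apply Rmult_integral_contrapositive; split; lra.
Qed.

(** F(0) = -1/2, and F(1/2) > 0 since the second term of F alone is at least 1/2
    there. *)
Lemma F_root K m lambda : 1 <= K -> 0 < lambda -> (1 <= m)%nat ->
  exists R0, root_in_unit_interval K m lambda R0.
Proof.
  intros HK Hl Hm.
  assert (F0 : F K m lambda 0 < 0).
  { unfold F. destruct m; [lia|]. rewrite pow_ne_zero by lia. 
    replace (0 / (1 - 0) + 0 / (1 - 0) ^ 2 + lambda * (K - 1 + 0 * (K + 1)) * 0 / ((K + 1) * (1 - 0)) - 1 / 2)
      with (- (1 / 2)) by (field; lra). lra. }
  assert (F1 : 0 < F K m lambda (1 / 2)).
  { unfold F. destruct (pow_in_unit (1 / 2) m Hm) as [P1 P2]; [lra|].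
    assert (P : 0 < (1 / 2) ^ m) by (apply pow_lt; lra).
    set (x := (1 / 2) ^ m) in *.
    assert (A : 0 < x / (1 - x)) by (apply Rdiv_lt_0_compat; lra).
    assert (B : 1 / 2 <= 1 / 2 / (1 - x) ^ 2).
    { unfold Rdiv at 2. rewrite <- (Rmult_1_r (1 / 2)) at 1. apply Rmult_le_compat_l; [lra|].
      rewrite <- Rinv_1 at 1. apply Rinv_le_contravar. apply pow_lt; lra.
      rewrite <- (pow1 2). apply pow_incr; lra. }
    assert (0 <= lambda * (K - 1 + 1 / 2 * (K + 1)) * (1 / 2) / ((K + 1) * (1 - 1 / 2))).
    { apply Rmult_le_pos. repeat apply Rmult_le_pos; lra. 
      apply Rlt_le, Rinv_0_lt_compat, Rmult_lt_0_compat; lra. }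
    lra. }
  destruct (IVT_interv (F K m lambda) 0 (1 / 2)) as [x [Hx E]]; auto; try lra.
  { intros r Hr. apply F_continuous; auto; lra. }
  exists x. split; auto. split; [|lra]. destruct (proj1 Hx) as [|<-]; auto. lra.
Qed.

(** * Sharpness: the map onto a half-plane *)

Definition half_plane_map (z : C) : C := (z / (1 - z))%C.

Lemma one_minus_neq0 (z : C) : Cmod z < 1 -> (1 - z)%C <> RtoC 0.
Proof.
  intros H. apply Csub_neq. intros <-. rewrite Cmod_1 in H. lra.
Qed.

Lemma series_at_geometric (q z : C) : Cmod (q * z) < 1 ->
  series_at (fun n => q ^ n)%C z (/ (1 - q * z))%C.
Proof.
  intros H. unfold series_at. pose proof (one_minus_neq0 _ H) as N.
  apply Clim_squeeze with (fun n => / Cmod (1 - q * z) * Cmod (q * z) ^ n).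
  - intros n. right. rewrite <- Cmod_inv, <- Cmod_pow, <- Cmod_mult, <- Cmod_opp by auto. f_equal.
    assert (E : psum (fun n => q ^ n)%C z n = csum (fun j => (q * z) ^ j)%C n).
    { apply csum_ext. intros. now rewrite Cpow_mult_l. }
    rewrite E. clear E.
    pose proof (csum_geometric (q * z) n) as G.
    replace ((q * z) ^ n)%C with (1 + (q * z - 1) * csum (fun j => (q * z) ^ j) n)%C
      by (rewrite G; ring).
    field. auto.
  - apply is_lim_seq_scaled_0, is_lim_seq_geom. rewrite Rabs_pos_eq; auto using Cmod_ge_0.
Qed.

(** The geometric series of 1/(1-z) about z0, using z/(1-z) = 1/(1-z) - 1. *)
Lemma half_plane_map_series (z0 s : C) : Cmod z0 < 1 -> Cmod s < Cmod (1 - z0) -> 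
  series_at (fun n => (/ (1 - z0)) * (/ (1 - z0)) ^ n
     + match n with O => RtoC (-1) | S _ => RtoC 0 end)%C s (half_plane_map (z0 + s)).
Proof.
  intros Hz Hs. pose proof (one_minus_neq0 _ Hz) as N.
  pose proof (proj1 (Cmod_gt_0 _) N) as N'.
  assert (Q : Cmod (/ (1 - z0) * s) < 1).
  { rewrite Cmod_mult, Cmod_inv by auto. apply Rmult_lt_reg_l with (Cmod (1 - z0)); auto.
    rewrite <- Rmult_assoc, Rinv_r; lra. }
  assert (N1 : (1 - (z0 + s))%C <> RtoC 0).
  { apply Cmod_gt_0. pose proof (Cmod_triangle_inv (1 - z0) s) as T.
    replace (1 - z0 - s)%C with (1 - (z0 + s))%C in T by ring. lra. }
  replace (half_plane_map (z0 + s))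
    with (/ (1 - z0) * / (1 - / (1 - z0) * s) + RtoC (-1))%C.
  - apply series_at_plus. apply series_at_scal, series_at_geometric; auto. apply series_at_delta.
  - unfold half_plane_map. replace (RtoC (-1)) with (- RtoC 1)%C by now rewrite <- RtoC_opp.
    assert ((1 - z0 - s)%C <> RtoC 0) by (replace (1 - z0 - s)%C with (1 - (z0 + s))%C by ring; auto).
    field. repeat split; auto.
Qed.

Lemma half_plane_map_sums_on :
  sums_on 1 (fun n => match n with O => RtoC 0 | S _ => RtoC 1 end) half_plane_map.
Proof.
  intros z Hz. pose proof (half_plane_map_series 0 z) as H.
  replace (1 - 0)%C with (RtoC 1) in H by ring. rewrite Cmod_0, Cmod_1, Cplus_0_l in H.
  eapply Clim_ext. 2: apply H; lra. intros n. apply csum_ext. intros k _.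
  replace (/ 1)%C with (RtoC 1) by field. rewrite Cpow_1_l.
  destruct k; [|ring]. replace (RtoC (-1)) with (- RtoC 1)%C by now rewrite <- RtoC_opp. ring.
Qed.

Lemma half_plane_map_analytic : analytic_on unit_disc half_plane_map.
Proof.
  intros z0 Hz. pose proof (proj1 (Cmod_gt_0 _) (one_minus_neq0 _ Hz)) as N.
  eexists. apply locally_C. exists (mkposreal _ N). intros z Hs.
  change (Cmod (z - z0) < Cmod (1 - z0)) in Hs.
  apply is_pseries_series_at. replace z with (z0 + (z - z0))%C at 2 by ring.
  apply half_plane_map_series; auto.
Qed.

(** |z| < 1 amounts to |w| < |1 + w| for w = z/(1-z). *)
Lemma half_plane_map_image w : image half_plane_map unit_disc w <-> - (1 / 2) < fst w.
Proof.
  assert (E : forall z w : C, (1 - z)%C <> RtoC 0 -> half_plane_map z = w -> z = (w * (1 - z))%C).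
  { intros z v N <-. unfold half_plane_map. field. auto. }
  assert (Sq : forall v : C, Cmod (1 + v) * Cmod (1 + v) = Cmod v * Cmod v + (1 + 2 * fst v)).
  { intros v. pose proof (Cmod_sqr v) as E1. pose proof (Cmod_sqr (1 + v)) as E2.
    simpl in E1, E2. lra. }
  split.
  - intros [z [Hz Hw]]. pose proof (one_minus_neq0 _ Hz) as N. specialize (E z w N Hw).
    assert (E1 : ((1 + w) * (1 - z))%C = RtoC 1) by (rewrite Cmult_plus_distr_r, <- E; ring).
    assert (E2 : Cmod z = Cmod w * Cmod (1 - z)) by (rewrite <- Cmod_mult; now f_equal).
    assert (E3 : Cmod (1 + w) * Cmod (1 - z) = 1) by (rewrite <- Cmod_mult, E1; apply Cmod_1).
    apply Cmod_gt_0 in N. unfold unit_disc in Hz.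
    assert (L : Cmod w < Cmod (1 + w)) by (apply Rmult_lt_reg_r with (Cmod (1 - z)); lra).
    specialize (Sq w). pose proof (Cmod_ge_0 w).
    assert (Cmod w * Cmod w < Cmod (1 + w) * Cmod (1 + w)) by (apply Rmult_le_0_lt_compat; lra).
    lra.
  - intros Hw.
    assert (L : Cmod w < Cmod (1 + w)).
    { apply Rnot_le_lt. intros HL. specialize (Sq w). pose proof (Cmod_ge_0 (1 + w)).
      assert (Cmod (1 + w) * Cmod (1 + w) <= Cmod w * Cmod w) by (apply Rmult_le_compat; lra).
      lra. }
    assert (N : (1 + w)%C <> RtoC 0) by (apply Cmod_gt_0; pose proof (Cmod_ge_0 w); lra).
    exists (w / (1 + w))%C. split.
    + unfold unit_disc. rewrite Cmod_div by auto. apply Cmod_gt_0 in N.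
      apply Rmult_lt_reg_r with (Cmod (1 + w)); auto. unfold Rdiv. rewrite Rmult_assoc, Rinv_l; lra.
    + unfold half_plane_map. field. split; auto.
      replace (1 + w - w)%C with (RtoC 1) by ring. intros H. apply RtoC_inj in H. lra.
Qed.

Lemma half_plane_map_convex_univalent : convex_univalent half_plane_map.
Proof.
  split; [apply half_plane_map_analytic|split].
  - intros z w Hz Hw E. pose proof (one_minus_neq0 _ Hz). pose proof (one_minus_neq0 _ Hw).
    unfold half_plane_map in E.
    assert (G : (z / (1 - z) + 1 = / (1 - z))%C) by (field; auto).
    assert (G' : (w / (1 - w) + 1 = / (1 - w))%C) by (field; auto).
    rewrite E, G' in G.
    replace z with (1 - / / (1 - z))%C by (field; auto). rewrite <- G. field. auto.
  - intros p q t Hp Hq Ht. apply half_plane_map_image in Hp. apply half_plane_map_image in Hq.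
    apply half_plane_map_image. simpl.
    apply Rmult_lt_compat_l with (r := 1) in Hp; [|lra].
    destruct (Req_dec t 0) as [->|Ht0]. lra.
    assert (t * - (1 / 2) < t * fst q) by (apply Rmult_lt_compat_l; lra).
    assert ((1 - t) * - (1 / 2) <= (1 - t) * fst p) by (apply Rmult_le_compat_l; lra). lra.
Qed.

Lemma half_plane_map_0 : half_plane_map (RtoC 0) = RtoC 0.
Proof. unfold half_plane_map. unfold Cdiv. ring. Qed.

Lemma half_plane_map_dist :
  dist_to_set (half_plane_map (RtoC 0)) (boundary (image half_plane_map unit_disc)) <= 1 / 2.
Proof.
  assert (Hb : boundary (image half_plane_map unit_disc) (RtoC (- (1 / 2)))).
  { intros eps. pose proof (cond_pos eps) as He. split.
    - exists (RtoC (- (1 / 2) + eps / 2)). split.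
      + rewrite <- RtoC_minus, Cmod_R, Rabs_pos_eq; lra.
      + apply half_plane_map_image. simpl. lra.
    - exists (RtoC (- (1 / 2))). split. rewrite Cmod_refl. auto.
      rewrite half_plane_map_image. simpl. lra. }
  assert (Hex : exists b, boundary (image half_plane_map unit_disc) b) by eauto.
  destruct (dist_to_set_approx (half_plane_map (RtoC 0)) _ Hex) as [_ [H _]].
  specialize (H _ Hb). rewrite half_plane_map_0 in *.
  replace (RtoC (- (1 / 2)) - 0)%C with (RtoC (- (1 / 2))) in H by ring.
  rewrite Cmod_R, Rabs_Ropp, Rabs_pos_eq in H; lra.
Qed.

Lemma C_derive_scaled_half_plane_map (a z : C) : Cmod z < 1 ->
  C_derive (fun z => a * half_plane_map z)%C z = (a / (1 - z) ^ 2)%C.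
Proof.
  intros Hz. pose proof (one_minus_neq0 _ Hz) as N.
  rewrite (reg_C_derive _ (fun w => (a / (1 - z)) * / (1 - w))%C).
  - field. auto.
  - apply reg_scal. apply reg_inv; auto. apply reg_minus. apply reg_const. apply reg_id.
  - apply near_impl with (2 := near_disc 1 z Hz). intros w Hw.
    pose proof (one_minus_neq0 _ Hw). unfold half_plane_map. field. auto.
Qed.

Lemma C_derive_half_plane_map (z : C) : Cmod z < 1 ->
  C_derive half_plane_map z = (/ (1 - z) ^ 2)%C.
Proof.
  intros Hz. pose proof (one_minus_neq0 _ Hz) as N.
  rewrite (reg_C_derive _ (fun w => / (1 - z) * / (1 - w))%C).
  - field. auto.
  - apply reg_scal. apply reg_inv; auto. apply reg_minus. apply reg_const. apply reg_id.
  - apply near_impl with (2 := near_disc 1 z Hz). intros w Hw.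
    pose proof (one_minus_neq0 _ Hw). unfold half_plane_map. field. auto.
Qed.

Lemma half_plane_map_R (x : R) : x <> 1 -> half_plane_map (RtoC x) = RtoC (x / (1 - x)).
Proof. intros H. unfold half_plane_map. rewrite RtoC_div, RtoC_minus by lra. reflexivity. Qed.

(** Here a_n = 1 for n >= 1 and b_n = k a_n, so that at a positive radius the modulus
    signs disappear. *)
Lemma extremal_bohr_sum K m lambda r : 1 <= K -> (1 <= m)%nat -> 0 <= r < 1 ->
  bohr_sum m lambda half_plane_map
    (fun n => match n with O => RtoC 0 | S _ => RtoC 1 end)
    (fun n => RtoC ((K - 1) / (K + 1)) * match n with O => RtoC 0 | S _ => RtoC 1 end)%C
    (RtoC r) = F K m lambda r + 1 / 2.
Proof.
  intros HK Hm Hr. destruct (pow_in_unit r m Hm Hr) as [P1 P2].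
  unfold bohr_sum. rewrite Cmod_R, (Rabs_pos_eq r) by lra.
  rewrite <- RtoC_pow.
  assert (Hk : 0 <= (K - 1) / (K + 1)).
  { apply Rmult_le_pos; [lra|]. apply Rlt_le, Rinv_0_lt_compat; lra. }
  rewrite C_derive_half_plane_map by (rewrite Cmod_R, Rabs_pos_eq; lra).
  rewrite half_plane_map_R by lra.
  replace (/ (1 - RtoC (r ^ m)) ^ 2)%C with (RtoC (/ (1 - r ^ m) ^ 2)).
  2: { rewrite RtoC_inv, RtoC_pow, RtoC_minus. reflexivity. apply pow_nonzero; lra. }
  rewrite !Cmod_R.
  assert (I : 0 < / (1 - r ^ m)) by (apply Rinv_0_lt_compat; lra).
  rewrite (Rabs_pos_eq (r ^ m / (1 - r ^ m))) by (apply Rmult_le_pos; lra).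
  rewrite Rabs_pos_eq by (apply Rlt_le, Rinv_0_lt_compat, pow_lt; lra).
  assert (G : forall A, is_series (fun n => A * r ^ n) (A / (1 - r))).
  { intros A. apply is_series_scaled_geom. rewrite Rabs_pos_eq; lra. }
  rewrite (Series_ext _ (fun n => r ^ 2 * r ^ n)).
  2: { intros n. replace (n + 2)%nat with (S (S n)) by lia. rewrite Cmod_1. simpl. ring. }
  rewrite (is_series_unique _ _ (G _)).
  rewrite (Series_ext _ (fun n => ((K - 1) / (K + 1) * r) * r ^ n)).
  2: { intros n. replace (n + 1)%nat with (S n) by lia. rewrite Cmod_mult, Cmod_1, Cmod_R, Rabs_pos_eq by auto.
    simpl. ring. }
  rewrite (is_series_unique _ _ (G _)).
  unfold F. field. lra.
Qed.

Lemma analytic_on_id U : analytic_on U (fun z => z).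
Proof.
  intros z0 _. exists (fun n => match n with O => z0 | S j => match j with O => RtoC 1 | S _ => RtoC 0 end end).
  apply filter_forall. intros z. apply is_pseries_series_at.
  replace z with (z0 + (z - z0) * 1)%C at 2 by ring.
  apply (series_at_tail (fun n => match n with O => z0 | S j => match j with O => RtoC 1 | S _ => RtoC 0 end end)).
  apply series_at_delta.
Qed.

Lemma analytic_on_scal U a f : analytic_on U f -> analytic_on U (fun z => a * f z)%C.
Proof.
  intros H z0 Hz. destruct (H z0 Hz) as [c Hc].
  exists (fun n => a * c n)%C. revert Hc. apply filter_imp. intros z Hc.
  apply is_pseries_series_at. apply is_pseries_series_at in Hc. now apply series_at_scal.
Qed.

Lemma extremal_quasiconformal K : 1 <= K ->
  let k := RtoC ((K - 1) / (K + 1)) in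
  sense_preserving_qc K (fun z => half_plane_map z + Cconj (k * half_plane_map z))%C
    half_plane_map (fun z => k * half_plane_map z)%C.
Proof.
  intros HK k. 
  assert (Hk : 0 <= (K - 1) / (K + 1) < 1).
  { split. apply Rmult_le_pos; [lra|]. apply Rlt_le, Rinv_0_lt_compat; lra.
    apply Rmult_lt_reg_r with (K + 1). lra. unfold Rdiv. rewrite Rmult_assoc, Rinv_l; lra. }
  split; [apply half_plane_map_analytic|]. split; [apply analytic_on_scal, half_plane_map_analytic|].
  split; [reflexivity|]. intros z Hz. pose proof (one_minus_neq0 _ Hz) as N.
  assert (N2 : ((1 - z) ^ 2)%C <> RtoC 0) by now apply Cpow_nz.
  unfold dilatation. rewrite C_derive_half_plane_map, C_derive_scaled_half_plane_map by exact Hz.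
  replace (k / (1 - z) ^ 2 / / (1 - z) ^ 2)%C with k by (field; auto).
  unfold k. rewrite Cmod_R, Rabs_pos_eq by apply Hk. split; [|lra].
  apply Cmod_gt_0. rewrite Cmod_inv by auto. apply Rinv_0_lt_compat. now apply Cmod_gt_0.
Qed.

Lemma extremal_not_bohr K m lambda rho r : 1 <= K -> (1 <= m)%nat -> 0 <= r < 1 -> r <= rho ->
  0 < F K m lambda r -> ~ bohr_inequality_up_to K m lambda rho.
Proof.
  intros HK Hm Hr Hrho HF HB.
  assert (Cr : Cmod (RtoC r) = r) by (rewrite Cmod_R, Rabs_pos_eq; lra).
  assert (B : bohr_sum m lambda half_plane_map
    (fun n => match n with O => RtoC 0 | S _ => RtoC 1 end)
    (fun n => RtoC ((K - 1) / (K + 1)) * match n with O => RtoC 0 | S _ => RtoC 1 end)%C (RtoC r)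
    <= Cmod (half_plane_map (RtoC 0)) + dist_to_set (half_plane_map (RtoC 0))
         (boundary (image half_plane_map unit_disc))).
  { eapply HB.
    - now apply extremal_quasiconformal.
    - split. ring. intros z Hz. pose proof (half_plane_map_sums_on z Hz).
      split; apply is_pseries_series_at; auto. now apply series_at_scal.
    - exact half_plane_map_convex_univalent.
    - exists (fun z => z). split; [apply analytic_on_id|auto].
    - unfold unit_disc. lra.
    - lra. }
  rewrite extremal_bohr_sum in B by auto. pose proof half_plane_map_dist as D.
  rewrite half_plane_map_0, Cmod_0 in B. rewrite half_plane_map_0 in D. lra.
Qed.

Theorem theorem2p3 (K lambda : R) (m : nat)
    (hK : 1 <= K) (hlambda : 0 < lambda) (hm : (1 <= m)%nat) :
  exists Rss : R,
    unique (root_in_unit_interval K m lambda) Rss /\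
    bohr_inequality_up_to K m lambda (Rmin (1 / 3) Rss) /\
    (Rss <= 1 / 3 ->
     forall rho : R, Rss < rho -> ~ bohr_inequality_up_to K m lambda rho).
Proof.
  destruct (F_root K m lambda hK hlambda hm) as [Rss [HR HF]].
  exists Rss. split; [|split].
  - split; [split; auto|]. intros s [Hs HFs].
    destruct (Rtotal_order Rss s) as [H|[H|H]]; auto; exfalso.
    + pose proof (F_increasing K m lambda Rss s hK hlambda hm ltac:(lra) ltac:(lra)). lra.
    + pose proof (F_increasing K m lambda s Rss hK hlambda hm ltac:(lra) ltac:(lra)). lra.
  - intros f h g a b phi Hqc Hpow Hphi Hsub z Hz Hzr.
    pose proof (Rle_trans _ _ _ Hzr (Rmin_l _ _)) as H3.
    pose proof (Rle_trans _ _ _ Hzr (Rmin_r _ _)) as HzR.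
    destruct (bohr_sum_bound K m lambda f h g a b phi z) as [Hd HB]; auto.
    set (d := dist_to_set _ _) in *.
    assert (HFz : F K m lambda (Cmod z) <= 0).
    { destruct (Rle_lt_or_eq_dec _ _ HzR) as [Hlt| ->]; [|lra].
      rewrite <- HF. apply Rlt_le, F_increasing; auto; try lra. split; auto using Cmod_ge_0. }
    assert (2 * d * (F K m lambda (Cmod z) + 1 / 2) <= 2 * d * (1 / 2))
      by (apply Rmult_le_compat_l; lra). lra.
  - intros _ rho Hrho. set (r := Rmin rho ((1 + Rss) / 2)).
    assert (Hr : Rss < r) by (apply Rmin_glb_lt; lra).
    pose proof (Rmin_l rho ((1 + Rss) / 2)) as L1. pose proof (Rmin_r rho ((1 + Rss) / 2)) as L2.
    fold r in L1, L2.
    apply extremal_not_bohr with r; auto; try lra.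
    rewrite <- HF. apply F_increasing; auto; lra.
Qed.
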